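(* Assume that $u_0\in H^3(\mathbb{R})$ and let $u\in C^0([0,T),H^3(\mathbb{R}))\cap C^1([0,T),H^2(\mathbb{R}))$ be the corresponding solution of $$u_t-u_{txx}+uu_x-uu_{xxx}=0,\qquad u(0,x)=u_0(x).$$ Let $m_0=u_0-u_0''$ and suppose that $m_0\in L^1(\mathbb{R})$ and that the sign of $m_0$ does not change. If there exists a rectangle $\Omega=(t_0,t_1)\times(x_0,x_1)\subseteq[0,T)\times\mathbb{R}$ (with $t_0<t_1$ and $x_0<x_1$) such that $u\big|_\Omega\equiv0$, then $u$ vanishes everywhere.
   Context: $H^s(\mathbb{R})$ is the usual Sobolev space; $T>0$ is the lifespan of the solution, which exists and is unique by local well-posedness in $H^s(\mathbb{R})$, $s>3/2$. ''The sign of $m_0$ does not change'' means $m_0\ge0$ everywhere or $m_0\leq0$ everywhere. *)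

(* Defs.v *)
From HB Require Import structures.
From mathcomp Require Import all_boot all_order all_algebra.
From mathcomp Require Import all_classical all_reals all_analysis.

Set Implicit Arguments.
Unset Strict Implicit.
Unset Printing Implicit Defensive.

Import Order.TTheory GRing.Theory Num.Theory.
Import numFieldNormedType.Exports.

Local Open Scope classical_set_scope.
Local Open Scope ring_scope.

Section Sobolev.
Context {R : realType}.
Let mu := @lebesgue_measure R.

(* C_c^oo(R) *)
Definition test_function (phi : R -> R) : Prop :=
  (forall n x, derivable (derive1n n phi) x 1) /\
  compact (closure [set x | phi x != 0]).

Definition weak_derivative (j : nat) (f g : R -> R) : Prop :=
  [/\ locally_integrable setT f, locally_integrable setT g &
    forall phi : R -> R, test_function phi ->
      \int[mu]_x (f x * derive1n j phi x) = (-1) ^+ j * \int[mu]_x (g x * phi x)].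

(* A chosen weak derivative: it is unique only up to almost-everywhere
   equality, and it is the zero function if f has no j-th weak derivative. *)
Definition wderiv (j : nat) (f : R -> R) : R -> R :=
  xget (cst 0) [set g | weak_derivative j f g].

(* H^k(R) = W^{k,2}(R); its elements are represented by functions, two
   functions being the same element when they agree almost everywhere. *)
Definition sobolev (k : nat) : set (R -> R) :=
  [set f | forall j, (j <= k)%N ->
    exists2 g, weak_derivative j f g & g \in Lfun mu 2%:E].

(* This is the H^k-norm only for f in sobolev k (see wderiv). *)
Definition sobolev_norm (k : nat) (f : R -> R) : \bar R :=
  ((\sum_(j < k.+1) ('N[mu]_(2%:E)[EFin \o wderiv j f]) ^+ 2) `^ 2^-1)%E.

(* [0, T), where T may be +oo *)
Definition lifetime (T : \bar R) : set R := [set t | 0 <= t /\ (t%:E < T)%E].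

(* v belongs to C^0([0, T), H^k) *)
Definition C0_sobolev (T : \bar R) (k : nat) (v : R -> R -> R) : Prop :=
  (forall t, lifetime T t -> sobolev k (v t)) /\
  (forall t, lifetime T t ->
    sobolev_norm k (v s \- v t) @[s --> within (lifetime T) (nbhs t)] --> 0%E).

(* v belongs to C^1([0, T), H^k), with time derivative vt; the derivative at
   t = 0 is one-sided. *)
Definition C1_sobolev (T : \bar R) (k : nat) (v vt : R -> R -> R) : Prop :=
  [/\ C0_sobolev T k v, C0_sobolev T k vt &
    forall t, lifetime T t ->
      sobolev_norm k (fun x => (v s x - v t x) / (s - t) - vt t x)
        @[s --> within (lifetime T) t^'] --> 0%E].

(* u belongs to C^0([0, T), H^3) and C^1([0, T), H^2), and solves
     u_t - u_txx + u u_x - u u_xxx = 0,   u(0, x) = u0(x).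
   With this regularity every term of the equation is an element of L^2(R) at
   each time t, whence the equality almost everywhere in x.  Each u t is the
   continuous representative of its class in H^3(R), so that the pointwise
   values of u and of u0 = u 0 are meaningful, and u0 is of class C^2. *)
Definition solution (T : \bar R) (u0 : R -> R) (u : R -> R -> R) : Prop :=
  [/\ C0_sobolev T 3 u,
      forall t, lifetime T t -> continuous (u t),
      forall x, u 0 x = u0 x &
      exists2 ut, C1_sobolev T 2 u ut &
        forall t, lifetime T t ->
          {ae mu, forall x,
            ut t x - wderiv 2 (ut t) x
              + u t x * wderiv 1 (u t) x - u t x * wderiv 3 (u t) x = 0}].

Definition momentum (f : R -> R) : R -> R := fun x => f x - derive1n 2 f x.

End Sobolev.

(* Main.v *)
Require Import Defs.
From mathcomp Require Import all_boot all_order all_algebra.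
From mathcomp Require Import all_classical all_reals all_analysis.
From mathcomp Require Import measurable_realfun ring lra.
Import Order.TTheory GRing.Theory Num.Theory.
Import numFieldNormedType.Exports.
Local Open Scope classical_set_scope.
Local Open Scope ring_scope.

(** The momentum m = u - u_xx is transported, m_t + u m_x = 0.  Hence, for
    phi = x^2 or the square of the positive or negative part, the energy
    E(t) = int phi(m) satisfies E' = int u_x phi(m), so |E'| <= sup |u_x| E,
    and by Gronwall, forwards and backwards in time, E vanishes at all times as
    soon as it vanishes at one.  Thus m keeps its sign.  At a time t at which u
    vanishes on an interval, the functions e^-x (u + u_x) and e^x (u - u_x) are
    monotone (their derivatives are -e^-x m and e^x m), vanish at a point of the
    interval, and tend to 0 at +oo and -oo respectively; so m = 0 at time t,
    hence at all times, and u = u_xx with u in L^2 forces u = 0. *)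

(** * Smooth functions and a smooth step *)

(** The available regularity shapes the argument. At a fixed time [u_xxx] is only a weak derivative
    in L^2, so m is merely in H^1, and m_t exists only as an L^2 limit of difference quotients.
    Hence no characteristics and no pointwise derivative in time: an energy is differentiated by
    integrating a quadratic Taylor bound for phi over the line. This is why the sign is tested with
    the square of the positive part, which is C^1 with Lipschitz derivative, and not with the
    positive part itself. Quadratic growth of phi also makes every energy finite for m in L^2.

    The formula for E' is an integration by parts: E' = - int phi'(m) u m_x = - int u (phi(m))_x =
    int u_x phi(m). Gronwall's constant is finite because sup |u_x| is controlled by the H^1 norm of
    u_x, which is continuous in time and so bounded on compact time intervals.

    Weak derivatives are known only through test functions. A smooth step is therefore built by
    hand, to show that a function with a weak derivative is almost everywhere an integral of it. *)

Section smooth.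
Set Implicit Arguments.
Unset Strict Implicit.
Context {R : realType}.
Implicit Types (f g : R -> R) (S : set (R -> R)).

Definition smooth f := forall n x, derivable (derive1n n f) x 1.

Lemma is_derive_derive1 f g : (forall x : R, is_derive x (1 : R) f (g x)) -> (derive1 f) = g.
Proof.
move=> fg; apply/funext => x; rewrite derive1E.
by have := fg x => H; rewrite derive_val.
Qed.

(** A coinduction principle: smoothness of [f] follows by exhibiting a set containing [f] and stable
    under differentiation, so no formula for the n-th derivative is ever required. *)
Lemma smooth_coind S :
  (forall f, S f -> exists2 g, S g & forall x : R, is_derive x (1 : R) f (g x)) ->
  forall f, S f -> smooth f.
Proof.
move=> SS f Sf n; elim: n f Sf => [|n IH] f Sf x.
  by have [g _ fg] := SS _ Sf; have := fg x => H; exact: ex_derive.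
have [g Sg fg] := SS _ Sf.
by rewrite derive1Sn (is_derive_derive1 fg); exact: IH.
Qed.

Lemma smooth_is_derive f : smooth f -> forall x : R, is_derive x (1 : R) f (derive1 f x).
Proof.
move=> sf x; rewrite derive1E; apply: derivableP; exact: (sf 0%N).
Qed.

Lemma smooth_derive1 f : smooth f -> smooth (derive1 f).
Proof. by move=> sf n x; rewrite -derive1Sn; exact: sf. Qed.

Lemma smoothB f g : smooth f -> smooth g -> smooth (f \- g).
Proof.
pose S := [set h | exists f g, [/\ h = f \- g, smooth f & smooth g]].
suff H : forall h, S h -> smooth h by move=> sf sg; apply: H; exists f, g.
apply: smooth_coind => _ [{}f [{}g [-> sf sg]]].
exists (derive1 f \- derive1 g).
  by exists (derive1 f), (derive1 g); split; [|exact: smooth_derive1..].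
by move=> x; apply: is_deriveB; exact: smooth_is_derive.
Qed.

Lemma is_derive_affine (a b x : R) : is_derive x (1 : R) (fun x => a * x + b) a.
Proof.
have := is_deriveD (is_deriveZ a (is_derive_id x 1)) (is_derive_cst b x 1).
by rewrite addr0 /GRing.scale /= mulr1.
Qed.

Lemma smooth_affine f a b c : smooth f -> smooth (fun x => c * f (a * x + b)).
Proof.
pose S := [set h | exists f c, h = (fun x => c * f (a * x + b)) /\ smooth f].
suff H : forall h, S h -> smooth h by move=> sf; apply: H; exists f, c.
apply: smooth_coind => _ [{}f [{}c [-> sf]]].
exists (fun x => (c * a) * derive1 f (a * x + b)).
  by exists (derive1 f), (c * a); split; [|exact: smooth_derive1].
move=> x; have h1 := smooth_is_derive sf (a * x + b).
have h3 := @is_derive1_comp R f (fun y => a * y + b) x _ _ h1 (is_derive_affine a b x).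
apply: is_derive_eq (is_deriveZ c h3) _.
by rewrite /GRing.scale/= -mulrA; congr (_ * _); rewrite mulrC.
Qed.

(** The smallest class that contains the products and that the Leibniz rule maps into itself; it is
    the set fed to [smooth_coind] in [smoothM]. *)
Inductive sum_of_products : set (R -> R) :=
| sum_of_products1 f g : smooth f -> smooth g -> sum_of_products (f \* g)
| sum_of_productsD f g :
    sum_of_products f -> sum_of_products g -> sum_of_products (f \+ g).

Lemma smoothM f g : smooth f -> smooth g -> smooth (f \* g).
Proof.
move=> sf sg; apply: (@smooth_coind sum_of_products) => [h|]; last first.
  exact: sum_of_products1.
elim=> {sf sg f g h} [f g sf sg|f g _ [f' Sf' ff'] _ [g' Sg' gg']].
  exists ((f \* derive1 g) \+ (g \* derive1 f)).
    by apply: sum_of_productsD; apply: sum_of_products1; [exact: sf|exact: smooth_derive1|exact: sg|exact: smooth_derive1].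
  by move=> x; apply: is_deriveM; exact: smooth_is_derive.
exists (f' \+ g'); first exact: sum_of_productsD.
by move=> x; exact: is_deriveD.
Qed.

(** The index [n] is there because differentiating exp(-1/x) produces powers of 1/x: the linear span
    of the [flat n] is stable under differentiation. *)
Definition flat (n : nat) (x : R) := if 0 < x then x ^- n * expR (- x^-1) else 0.


(** With y = 1/x, the exponential series gives e^y >= y^(n+2) / (n+2)!, hence the constant (n+2)!.
    The exponent 2 on the right is what differentiability at 0 requires. *)
Lemma flat_le n : exists C, forall x, `|flat n x| <= C * x ^+ 2.
Proof.
exists (n.+2)`!%:R => x; rewrite /flat; case: ifPn => [x0|_]; last first.
  by rewrite normr0 mulr_ge0// sqr_ge0.
have y0 : 0 <= x^-1 by rewrite invr_ge0 ltW.
rewrite ger0_norm ?mulr_ge0 ?invr_ge0 ?exprn_ge0 ?(ltW x0) ?expR_ge0//.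
have h0 := @expR_ge1Dxn R x^-1 n.+1 y0.
have : x^-1 ^+ n.+2 / (n.+2)`!%:R <= expR x^-1 by apply: le_trans h0; rewrite lerDr.
rewrite ler_pdivrMr ?ltr0n ?fact_gt0// expRN => h.
rewrite ler_pdivrMr ?expR_gt0// -mulrA [x ^+ 2 * _]mulrC mulrA [_ * expR _]mulrC.
rewrite -ler_pdivrMr ?exprn_gt0//; apply: le_trans h.
by rewrite -!exprVn -exprD addn2.
Qed.

Lemma is_derive_flat n (x : R) :
  is_derive x (1 : R) (flat n) (flat n.+2 x - n%:R * flat n.+1 x).
Proof.
have [x0|x0|->] := ltgtP x 0.
- apply: (@near_eq_is_derive R R R (cst 0)).
    near=> y; rewrite /flat ltNge ltW//=.
    by near: y; exact: lt_nbhsl.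
  by rewrite /flat ltNge (ltW x0)/= mulr0 subr0; exact: is_derive_cst.
- apply: (@near_eq_is_derive R R R (fun y => y ^- n * expR (- y^-1))).
    near=> y; rewrite /flat ifT//.
    by near: y; exact: lt_nbhsr.
  rewrite /flat !x0.
  have x_neq0 : x != 0 by rewrite gt_eqF.
  have hv : is_derive x (1 : R) (fun y => y^-1) (- x ^- 2).
    by have := @is_deriveV R id x 1 1 x_neq0 (is_derive_id _ _); rewrite /GRing.scale /= mulr1.
  have hX := @is_deriveX _ _ _ n x 1 _ hv.
  have hN : is_derive x (1 : R) (fun y => - y^-1) (x ^- 2).
    by have := is_deriveN hv; rewrite opprK.
  have hE := @is_derive1_comp R expR (fun y => - y^-1) x _ _ (is_derive_expR (- x^-1)) hN.
  have hM := is_deriveM hX hE.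
  rewrite (_ : (fun y => _) = ((fun y : R => y^-1) ^+ n) * (expR \o (fun y => - y^-1))); last first.
    by apply: funext => y; rewrite /= mulrfctE exprfctE exprVn.
  apply: is_derive_eq hM _.
  rewrite /GRing.scale /= exprfctE -!exprVn.
  case: n hX => [|n] hX /=.
    by rewrite !expr0 !mul0r !mulr0; ring.
  by rewrite !exprS; ring.
- rewrite /flat ltxx mulr0 subr0.
  have [C HC] := flat_le n.
  (* At 0 the bound [flat_le] makes the difference quotient O(|h|), so the derivative is 0. *)
  have H0 : (fun h => h^-1 *: (flat n (h *: 1 + 0) - flat n 0)) @ (0:R)^' --> (0:R).
    apply/cvgr0Pnorm_le => e e0.
    have C0 : 0 < `|C| + 1 by rewrite ltr_wpDl.
    near=> h.
    rewrite /GRing.scale /= mulr1 addr0 {2}/flat ltxx subr0 normrM normfV.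
    have h0 : 0 < `|h| by rewrite normr_gt0; near: h; exact: nbhs_dnbhs_neq.
    rewrite ler_pdivrMl//; apply: (le_trans (HC h)).
    rewrite -real_normK ?num_real// expr2 mulrCA ler_pM2l//.
    apply: (@le_trans _ _ ((`|C| + 1) * `|h|)).
      by rewrite ler_wpM2r// (le_trans (ler_norm C))// lerDl.
    rewrite -ler_pdivlMl// mulrC.
    by near: h; apply: dnbhs0_le; rewrite divr_gt0.
  rewrite -/(flat n); split; last by apply/cvg_lim.
  by apply/cvg_ex; exists 0.
Unshelve. all: by end_near. Qed.

Inductive flat_span : set (R -> R) :=
| flat_span1 c n : flat_span (fun x => c * flat n x)
| flat_spanB f g : flat_span f -> flat_span g -> flat_span (f \- g).

Lemma smooth_flat n : smooth (flat n).
Proof.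
have -> : flat n = (fun x => 1 * flat n x) by apply/funext => x; rewrite mul1r.
apply: (@smooth_coind flat_span); last exact: flat_span1.
move=> h; elim=> {n h} [c n|f g _ [f' Sf' ff'] _ [g' Sg' gg']]; last first.
  by exists (f' \- g'); [exact: flat_spanB|move=> x; exact: is_deriveB].
exists ((fun x => c * flat n.+2 x) \- (fun x => (c * n%:R) * flat n.+1 x)).
  by apply: flat_spanB; exact: flat_span1.
move=> x; apply: is_derive_eq (is_deriveZ c (is_derive_flat n x)) _.
by rewrite /GRing.scale/= mulrBr mulrA.
Qed.

Lemma smooth_cst c : smooth (cst c).
Proof.
apply: (@smooth_coind [set h | exists c, h = cst c]); last by exists c.
by move=> _ [{}c ->]; exists (cst 0); [exists 0|move=> x; exact: is_derive_cst].
Qed.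

Lemma smoothV g : smooth g -> (forall x, g x != 0) -> smooth (fun x => (g x)^-1).
Proof.
move=> sg g0.
pose S := [set h | exists f n, h = (fun x => f x * (g x)^-1 ^+ n) /\ smooth f].
suff H : forall h, S h -> smooth h.
  apply: H; exists (cst 1), 1%N; split; last exact: smooth_cst.
  by apply: funext => x; rewrite mul1r.
apply: smooth_coind => _ [f [n [-> sf]]].
exists (fun x => (derive1 f x * g x - n%:R * f x * derive1 g x) * (g x)^-1 ^+ n.+1).
  exists ((derive1 f \* g) \- ((cst n%:R \* f) \* derive1 g)), n.+1; split; first by [].
  apply: smoothB; apply: smoothM; [exact: smooth_derive1|exact: sg| |exact: smooth_derive1].
  by apply: smoothM; [exact: smooth_cst|exact: sf].
move=> x.
have hg := is_deriveV (g0 x) (smooth_is_derive sg x).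
have hX := @is_deriveX _ _ _ n x 1 _ hg.
have hM := is_deriveM (smooth_is_derive sf x) hX.
rewrite (_ : (fun x => _) = f * (fun x => (g x)^-1) ^+ n); last first.
  by apply: funext => y; rewrite /= mulrfctE exprfctE.
apply: is_derive_eq hM _.
rewrite /GRing.scale /= exprfctE -!exprVn.
case: n hX => [|n] hX /=.
  by rewrite !expr0 !mul0r !mulr0 expr1 mul1r add0r subr0 mulfK.
rewrite !exprS mulrBl [derive1 f x * g x * _]mulrA [derive1 f x * g x / _]mulfK//.
by ring.
Qed.

Lemma smooth_step : exists H, [/\ smooth H, forall x, x <= 0 -> H x = 0,
  forall x, 1 <= x -> H x = 1 & forall x, 0 <= H x <= 1].
Proof.
have flat0 x : x <= 0 -> flat 0 x = 0 by move=> x0; rewrite /flat ltNge x0.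
have flat_gt0 x : 0 < x -> 0 < flat 0 x.
  by move=> x0; rewrite /flat x0 mulr_gt0 ?expR_gt0// invr_gt0 exprn_gt0.
have flat_ge0 x : 0 <= flat 0 x.
  by case: (ltP 0 x) => [/flat_gt0/ltW//|/flat0 ->].
(* The step is flat(x) / (flat(x) + flat(1 - x)). The denominator is positive because x and 1 - x
   are never both nonpositive; its signs are arranged to fit [smoothB] and [smooth_affine]. *)
pose g x := flat 0 x - (-1) * flat 0 (-1 * x + 1).
have g_gt0 x : 0 < g x.
  rewrite /g mulN1r opprK; case: (ltP 0 x) => x0.
    by rewrite ltr_pwDl// flat_gt0.
  by rewrite ltr_wpDl// flat_gt0//; lra.
have sg : smooth g.
  by apply: smoothB; [exact: smooth_flat|apply: smooth_affine; exact: smooth_flat].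
exists (fun x => flat 0 x * (g x)^-1); split.
- apply: smoothM; first exact: smooth_flat.
  by apply: smoothV => // x; rewrite gt_eqF.
- by move=> x /flat0 ->; rewrite mul0r.
- move=> x x1; rewrite /g [flat 0 (_ + _)]flat0; last lra.
  by rewrite mulr0 subr0 divff// gt_eqF// flat_gt0//; lra.
- move=> x; rewrite divr_ge0// ?(ltW (g_gt0 x))//= ler_pdivrMr// mul1r /g.
  by rewrite mulN1r opprK lerDl.
Qed.

End smooth.

(** * Lebesgue integrals of real-valued functions *)

Section integrals.
Set Implicit Arguments.
Unset Strict Implicit.
Context {R : realType}.
Local Notation mu := (@lebesgue_measure R).
Implicit Types (f g h : R -> R) (A B D : set R).

Lemma ae_mono (P Q : R -> Prop) : (forall x, P x -> Q x) ->
  {ae mu, forall x, P x} -> {ae mu, forall x, Q x}.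
Proof. by move=> PQ; apply: (@filterS _ _ (ae_filter_ringOfSetsType mu)). Qed.

Lemma ae_mono2 (P Q S : R -> Prop) : (forall x, P x -> Q x -> S x) ->
  {ae mu, forall x, P x} -> {ae mu, forall x, Q x} -> {ae mu, forall x, S x}.
Proof. by move=> PQ; apply: (@filterS2 _ _ (ae_filter_ringOfSetsType mu)). Qed.

Lemma le_integrable_EFin D f g : measurable D -> measurable_fun D f ->
  (forall x, D x -> `|f x| <= g x) -> mu.-integrable D (EFin \o g) ->
  mu.-integrable D (EFin \o f).
Proof.
move=> mD mf fg ig; apply: le_integrable ig => //; first exact/measurable_EFinP.
by move=> x Dx; rewrite /= lee_fin (le_trans (fg _ Dx))// ler_norm.
Qed.

Lemma integrableZ_EFin D f c : measurable D -> mu.-integrable D (EFin \o f) ->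
  mu.-integrable D (EFin \o (fun x => c * f x)).
Proof. by move=> mD fi; have := integrableZl _ c fi; apply. Qed.

Lemma integrable_patch D f : measurable D -> mu.-integrable D (EFin \o f) ->
  mu.-integrable setT (EFin \o (f \_ D)).
Proof.
by move=> mD fi; rewrite -restrict_EFin; apply: (iffLR (integrable_mkcond _ _) fi).
Qed.

Lemma integrableD_EFin D f g : measurable D -> mu.-integrable D (EFin \o f) ->
  mu.-integrable D (EFin \o g) -> mu.-integrable D (EFin \o (fun x => f x + g x)).
Proof. by move=> mD fi gi; have := integrableD _ fi gi; apply. Qed.

Lemma integrableB_EFin D f g : measurable D -> mu.-integrable D (EFin \o f) ->
  mu.-integrable D (EFin \o g) -> mu.-integrable D (EFin \o (fun x => f x - g x)).
Proof. by move=> mD fi gi; have := integrableB _ fi gi; apply. Qed.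

Lemma integrable_bounded_mul D f h K : measurable D -> measurable_fun D h ->
  (forall x, D x -> `|h x| <= K) -> mu.-integrable D (EFin \o f) ->
  mu.-integrable D (EFin \o (fun x => f x * h x)).
Proof.
move=> mD mh hK fi.
apply: (@le_integrable_EFin _ _ (fun x => K * `|f x|)) => //.
- apply: measurable_funM mh; apply/measurable_EFinP; exact: measurable_int fi.
- by move=> x Dx; rewrite normrM mulrC ler_wpM2r// hK.
- by apply: integrableZ_EFin => //; exact: (integrable_norm fi).
Qed.

Lemma locally_integrable_itv f (a b : R) : locally_integrable setT f ->
  mu.-integrable `[a, b] (EFin \o f).
Proof.
move=> [mf _ fi]; apply/integrableP; split.
  by apply/measurable_EFinP; exact: measurable_funTS.
by under eq_integral do rewrite abse_EFin; apply: fi => //; exact: segment_compact.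
Qed.

Lemma Rintegral_support D f : (forall x, ~ D x -> f x = 0) ->
  \int[mu]_x f x = \int[mu]_(x in D) f x.
Proof.
move=> f0; rewrite [RHS]Rintegral_mkcond; apply: eq_Rintegral => x _.
by rewrite patchE; case: ifPn => // /negP; rewrite inE => /f0.
Qed.

Lemma ae_eq_Rintegral f g : measurable_fun setT f -> measurable_fun setT g ->
  {ae mu, forall x, f x = g x} -> \int[mu]_x f x = \int[mu]_x g x.
Proof.
move=> mf mg fg; congr fine; apply: ae_eq_integral => //.
- exact/measurable_EFinP.
- exact/measurable_EFinP.
- by apply: ae_mono fg => x -> _.
Qed.

Lemma ler_norm_Rintegral D f g : measurable D -> measurable_fun D f ->
  (forall x, D x -> `|f x| <= g x) -> mu.-integrable D (EFin \o g) ->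
  `|\int[mu]_(x in D) f x| <= \int[mu]_(x in D) g x.
Proof.
move=> mD mf fg ig; have fi := le_integrable_EFin mD mf fg ig.
apply: (le_trans (le_normr_Rintegral _ fi)) => //.
by apply: le_Rintegral => //; exact: (integrable_norm fi).
Qed.

Lemma ler_Rintegral_subset A B f : measurable A -> measurable B -> A `<=` B ->
  mu.-integrable B (EFin \o f) -> (forall x, B x -> 0 <= f x) ->
  \int[mu]_(x in A) f x <= \int[mu]_(x in B) f x.
Proof.
move=> mA mB AB fi f0; apply: fine_le.
- by apply: integrable_fin_num => //; apply: integrableS fi.
- exact: integrable_fin_num.
- apply: ge0_subset_integral => //; first exact: measurable_int fi.
Qed.

Lemma Rintegral_itv_chasles f (a b c : R) : a <= b -> b <= c ->
  mu.-integrable `[a, c] (EFin \o f) ->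
  \int[mu]_(x in `[a, c]) f x =
  \int[mu]_(x in `[a, b]) f x + \int[mu]_(x in `[b, c]) f x.
Proof.
move=> ab bc fi.
have := @Rintegral_itvB R f (BLeft a) (BRight c) b fi.
rewrite !bnd_simp => /(_ ab bc).
rewrite (Rintegral_itv_obnd_cbnd (r := b)).
  by move=> <-; rewrite addrC subrK.
by apply: integrableS fi => //; apply: subset_itvr; rewrite bnd_simp.
Qed.

Lemma Rintegral_FTC2 (f F : R -> R) (a b : R) : a <= b -> continuous f ->
  (forall x : R, is_derive x (1 : R) F (f x)) ->
  \int[mu]_(x in `[a, b]) f x = F b - F a.
Proof.
rewrite le_eqVlt => /predU1P[<- _ _|ab cf dF].
  by rewrite set_itv1 Rintegral_set1 subrr.
have dF' x : derivable F x 1 by have := dF x => H; exact: ex_derive.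
have cF x : {for x, continuous F}.
  by apply/differentiable_continuous/derivable1_diffP.
rewrite /Rintegral (@continuous_FTC2 _ f F)//.
- exact: continuous_subspaceT.
- split; first by move=> x _.
  + exact: cvg_at_right_filter (cF a).
  + exact: cvg_at_left_filter (cF b).
- by move=> x _; rewrite (is_derive_derive1 dF).
Qed.

Lemma continuous_locally_integrable f : continuous f -> locally_integrable setT f.
Proof.
move=> cf; split; [exact: continuous_measurable_fun|exact: openT|].
move=> K _ cK.
have /integrableP[_] := @continuous_compact_integrable R f K cK (continuous_subspaceT cf).
by under eq_integral do rewrite abse_EFin.
Qed.

End integrals.

(** * Weak derivatives *)

Section weak_derivatives.
Set Implicit Arguments.
Unset Strict Implicit.
Context {R : realType}.
Local Notation mu := (@lebesgue_measure R).
Implicit Types (f g : R -> R) (A B D : set R).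

Lemma smooth_continuous f : smooth f -> continuous f.
Proof.
by move=> sf x; apply/differentiable_continuous/derivable1_diffP; exact: (sf 0%N).
Qed.

Lemma test_function_itv f (a b : R) : smooth f ->
  (forall x, x \notin `[a, b] -> f x = 0) -> test_function f.
Proof.
move=> sf f0; split; first exact: sf.
apply: (@subclosed_compact _ _ `[a, b]); [exact: closed_closure|exact: segment_compact|].
have /closure_id abE : closed [set` `[a, b]] by exact: interval_closed.
rewrite [X in _ `<=` X]abE.
apply: closure_subset => x /= fx0; apply: contrapT => /negP xab.
by move/eqP : fx0; apply; exact: f0.
Qed.

Lemma test_function_derive1 f : test_function f -> test_function (derive1 f).
Proof.
move=> [sf cf]; split; first exact: smooth_derive1.
apply: subclosed_compact cf _; first exact: closed_closure.
have /closure_id CE : closed (closure [set x | f x != 0]) by exact: closed_closure.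
rewrite [X in _ `<=` X]CE; apply: closure_subset => x /= fx0; apply: contrapT => xf.
move/eqP : fx0; apply.
have : nbhs x (~` closure [set x | f x != 0]).
  by apply: open_nbhs_nbhs; split => //; apply: closed_openC; exact: closed_closure.
move=> nx; rewrite derive1E (@near_eq_derive _ _ _ f (cst 0)) ?derive_cst//.
near=> y; apply: contrapT => fy.
have : (~` closure [set x | f x != 0]) y by near: y.
by apply; apply: subset_closure; exact/eqP.
Unshelve. all: by end_near. Qed.

Let H := sval (cid (@smooth_step R)).

Let sH : smooth H. Proof. by case: (svalP (cid (@smooth_step R))). Qed.
Let H0 x : x <= 0 -> H x = 0. Proof. by case: (svalP (cid (@smooth_step R))) => _ + _ _; exact. Qed.
Let H1 x : 1 <= x -> H x = 1. Proof. by case: (svalP (cid (@smooth_step R))) => _ _ + _; exact. Qed.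
Let H01 x : 0 <= H x <= 1. Proof. by case: (svalP (cid (@smooth_step R))) => _ _ _; exact. Qed.

(** It rises from 0 to 1 on [x, x + 1/(n+1)], so its derivative is a one-sided mollifier at [x]. The
    shape [1 * H (a * y + b)] is that of [smooth_affine]. *)
Let step n (x y : R) : R := 1 * H (n.+1%:R * y + - (n.+1%:R * x)).

Let stepE n x y : step n x y = H (n.+1%:R * (y - x)).
Proof. by rewrite /step mul1r mulrBr. Qed.

Let smooth_step n x : smooth (step n x).
Proof. exact: smooth_affine. Qed.

Let step0 n x y : y <= x -> step n x y = 0.
Proof. by move=> yx; rewrite stepE H0// mulr_ge0_le0// subr_le0. Qed.

Let step1 n x y : x + n.+1%:R^-1 <= y -> step n x y = 1.
Proof. by move=> yx; rewrite stepE H1// -ler_pdivrMl// mulr1 lerBrDl. Qed.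

Let derive1_step n x y : derive1 (step n x) y = n.+1%:R * derive1 H (n.+1%:R * (y - x)).
Proof.
have h := @is_derive1_comp R H _ y _ _ (smooth_is_derive sH _)
  (is_derive_affine n.+1%:R (- (n.+1%:R * x)) y).
have := is_deriveZ 1 h => {}h.
rewrite derive1E; have -> : step n x = (1 : R) \*: (H \o (fun y => n.+1%:R * y + - (n.+1%:R * x))) by [].
by rewrite derive_val /GRing.scale/= mul1r mulrC mulrBr.
Qed.

Let derive1_H0 x : (x < 0) || (1 < x) -> derive1 H x = 0.
Proof.
case/orP => x0.
- rewrite derive1E (@near_eq_derive _ _ _ H (cst 0)) ?derive_cst//.
  by near=> y; rewrite H0// ltW//; near: y; exact: lt_nbhsl.
- rewrite derive1E (@near_eq_derive _ _ _ H (cst 1)) ?derive_cst//.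
  by near=> y; rewrite H1// ltW//; near: y; exact: lt_nbhsr.
Unshelve. all: by end_near. Qed.

Let derive1_H_bounded : exists K, forall x, `|derive1 H x| <= K.
Proof.
have cH : continuous (derive1 H) by apply: smooth_continuous; exact: smooth_derive1.
have := compact_bounded (continuous_compact (continuous_subspaceT cH) (@segment_compact R 0 1)).
move=> [M [_ HM]]; exists (`|M| + 1) => x.
have [x01|] := boolP (x \in `[0, 1]).
  by apply: (HM (`|M| + 1)); [rewrite (le_lt_trans (ler_norm M))// ltrDl|exists x].
rewrite in_itv/= negb_and -!ltNge => x01.
by rewrite derive1_H0// normr0 addr_ge0.
Qed.

Let derive1_step0 n x y : y \notin `[x, x + n.+1%:R^-1] -> derive1 (step n x) y = 0.
Proof.
rewrite in_itv/= negb_and -!ltNge derive1_step => xy.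
rewrite derive1_H0 ?mulr0//; case/orP: xy => xy; apply/orP; [left|right].
  by rewrite pmulr_rlt0// subr_lt0.
by rewrite -ltr_pdivrMl// mulr1 ltrBrDl.
Qed.

Let test_derive1_step n x : test_function (derive1 (step n x)).
Proof.
by apply: test_function_itv (@derive1_step0 n x); exact/smooth_derive1/smooth_step.
Qed.

(** The factor 2 in the radius makes the open ball around [x] contain the closed interval
    [x, x + 1/(n+1)] that supports the mollifier. *)
Let davg_cvg f x : lebesgue_pt f x ->
  (fun n => fine (davg f x (2 * n.+1%:R^-1))) @ \oo --> (0 : R).
Proof.
move=> fx; apply: fine_cvg; apply: cvg_comp fx => P [/= d d0 dP].
near=> n; apply: dP => /=; last by rewrite mulr_gt0.
rewrite sub0r normrN ger0_norm ?mulr_ge0// -ltr_pdivlMl//.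
near: n.
have d2 : 0 < 2^-1 * d by rewrite mulr_gt0.
exact: (near_infty_natSinv_lt (PosNum d2)).
Unshelve. all: by end_near. Qed.

Let fine_davg f x r : locally_integrable setT f -> 0 < r ->
  fine (davg f x r) * (r *+ 2) = \int[mu]_(y in ball x r) `|f y - f x|.
Proof.
move=> lf r0; rewrite /davg /iavg lebesgue_measure_ball ?ltW//.
rewrite inver mulrn_eq0/= gt_eqF// /Rintegral /=.
have r2 : r *+ 2 != 0 by rewrite mulrn_eq0/= gt_eqF.
have lf' : locally_integrable setT (fun y => f y - f x).
  apply: locally_integrableB lf _; apply: continuous_locally_integrable.
  exact: cst_continuous.
have fi : mu.-integrable (ball x r) (EFin \o (fun y => `|f y - f x|)).
  have fi := @locally_integrable_itv _ _ (x - r) (x + r) lf'.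
  apply: integrableS (integrable_norm fi) => //; first exact: measurable_ball.
  by rewrite ball_itv; exact: subset_itv_oo_cc.
have /fineK <- : (\int[mu]_(y in ball x r) (`|f y - f x|)%:E)%E \is a fin_num.
  by apply: integrable_fin_num => //; exact: measurable_ball.
by rewrite -EFinM /= mulrC mulVKf.
Qed.

(** The mollifier has mass 1, is bounded by K/e with e = 1/(n+1), and is supported in the ball of
    radius 2e. The error is thus at most K/e times the integral of |f - f x| over that ball of
    length 4e, which is 4K times the average deviation, and this tends to 0 at a Lebesgue point. *)
Let mollify f x : locally_integrable setT f -> lebesgue_pt f x ->
  (fun n => \int[mu]_y (f y * derive1 (step n x) y)) @ \oo --> f x.
Proof.
move=> lf fx.
have [K HK] := derive1_H_bounded.
have K0 : 0 <= K by apply: le_trans (HK 0).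
have lf' : locally_integrable setT (fun y => f y - f x).
  apply: locally_integrableB lf _; apply: continuous_locally_integrable.
  exact: cst_continuous.
have cs n : continuous (derive1 (step n x)).
  by apply: smooth_continuous; exact/smooth_derive1/smooth_step.
have main n : `|f x - \int[mu]_y (f y * derive1 (step n x) y)| <=
    (4 * K) * fine (davg f x (2 * n.+1%:R^-1)).
  set e := n.+1%:R^-1; have e0 : 0 < e by rewrite invr_gt0.
  have sK y : `|derive1 (step n x) y| <= e^-1 * K.
    by rewrite derive1_step normrM ger0_norm// /e invrK ler_wpM2l.
  have is_ : mu.-integrable `[x, x + e] (EFin \o derive1 (step n x)).
    exact/locally_integrable_itv/continuous_locally_integrable.

  have ms D : measurable_fun D (derive1 (step n x)).
    by apply: measurable_funTS; exact: continuous_measurable_fun.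
  have ifs g : locally_integrable setT g -> 
      mu.-integrable `[x, x + e] (EFin \o (fun y => g y * derive1 (step n x) y)).
    move=> lg; apply: (@integrable_bounded_mul _ _ _ _ (e^-1 * K)) => //.
    exact: locally_integrable_itv.
  have nf : mu.-integrable `[x, x + e] (EFin \o (fun y => `|f y - f x|)).
    exact/integrable_norm/locally_integrable_itv.
  rewrite (@Rintegral_support _ `[x, x + e]); last first.
    by move=> y /negP yx; rewrite derive1_step0 ?mulr0.
  have E : \int[mu]_(y in `[x, x + e]) derive1 (step n x) y = 1.
    rewrite (Rintegral_FTC2 _ (cs n) (smooth_is_derive (@smooth_step n x))).
      by rewrite step1// step0// subr0.
    by rewrite lerDl ltW.
  have ics : mu.-integrable `[x, x + e] (EFin \o (fun y => f x * derive1 (step n x) y)).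
    exact: integrableZ_EFin.
  have -> : f x - \int[mu]_(y in `[x, x + e]) (f y * derive1 (step n x) y) =
      - \int[mu]_(y in `[x, x + e]) (f y * derive1 (step n x) y - f x * derive1 (step n x) y).
    by rewrite (RintegralB _ (ifs _ lf) ics)// (RintegralZl _ _ is_)// E mulr1 opprB.
  rewrite normrN.
  apply: (@le_trans _ _ (\int[mu]_(y in `[x, x + e]) (e^-1 * K * `|f y - f x|))).
    apply: ler_norm_Rintegral => //.
    - apply: measurable_funB; apply: measurable_funM => //.
      by apply: measurable_funTS; case: lf.
    - move=> y _; rewrite -mulrBl normrM mulrC.
      by rewrite ler_wpM2r.
    - exact: integrableZ_EFin.
  rewrite RintegralZl//.
  have -> : 4 * K = e^-1 * K * (2 * e) *+ 2 by field; rewrite ?gt_eqF.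
  rewrite -mulrnAr -[leRHS]mulrA [(2 * e *+ 2) * _]mulrC fine_davg ?mulr_gt0//.
  rewrite ler_wpM2l//; first by rewrite mulr_ge0// invr_ge0 ltW.
  apply: ler_Rintegral_subset => //.
  - exact: measurable_ball.
  - rewrite ball_itv => y /=; rewrite !in_itv/= => /andP[xy yx]; apply/andP; split; lra.
  - have := @locally_integrable_itv _ _ (x - 2 * e) (x + 2 * e) lf'.
    move=> /integrable_norm; apply: integrableS => //; first exact: measurable_ball.
    by rewrite ball_itv; exact: subset_itv_oo_cc.
apply/cvgrPdist_le => eps eps0.
have h : ((fun=> 4 * K) \* (fun n => fine (davg f x (2 / n.+1%:R)))) n @[n --> \oo] --> (0 : R).
  by rewrite -(mulr0 (4 * K)); apply: cvgM (davg_cvg fx); exact: cvg_cst.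
move/cvgr0Pnorm_le : h => /(_ _ eps0) h.
near=> n; apply: (le_trans (main n)); apply: (le_trans (ler_norm _)).
by near: n; exact: h.
Unshelve. all: by end_near. Qed.

(** Almost every point is a Lebesgue point of both functions; there, testing with the mollifiers
    recovers both values as limits of the same sequence. *)
Lemma eq_ae_test_function f g :
  locally_integrable setT f -> locally_integrable setT g ->
  (forall phi, test_function phi ->
    \int[mu]_x (f x * phi x) = \int[mu]_x (g x * phi x)) ->
  {ae mu, forall x, f x = g x}.
Proof.
move=> lf lg fg.
apply: ae_mono2 (lebesgue_differentiation lf) (lebesgue_differentiation lg).
move=> x fx gx; have := mollify lg gx.
under eq_fun => n do rewrite -(fg _ (@test_derive1_step n x)).
by move=> /(cvg_unique (@Rhausdorff R) (mollify lf fx)).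
Qed.

Lemma weak_derivative_unique j f g1 g2 :
  weak_derivative j f g1 -> weak_derivative j f g2 ->
  {ae mu, forall x, g1 x = g2 x}.
Proof.
move=> [_ lg1 fg1] [_ lg2 fg2]; apply: eq_ae_test_function => // phi tphi.
by have := fg1 _ tphi; rewrite fg2// => /(mulfI (lreg_neq0 (@lreg_sign _ j))).
Qed.

Lemma integrable_mul_test_function f phi : locally_integrable setT f ->
  test_function phi -> mu.-integrable setT (EFin \o (fun x => f x * phi x)).
Proof.
move=> [mf _ fi] [sphi cK].
have cphi := smooth_continuous sphi.
set K := closure _ in cK.
have mK : measurable K by exact: compact_measurable.
have [M [_ HM]] := compact_bounded (continuous_compact (continuous_subspaceT cphi) cK).
have -> : (fun x => f x * phi x) = (fun x => f x * phi x) \_ K.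
  apply: funext => x; rewrite patchE; case: ifPn => // /negP xK.
  have [->|x0] := eqVneq (phi x) 0; first by rewrite mulr0.
  by exfalso; apply: xK; rewrite inE; exact: subset_closure.
have {}fi : mu.-integrable K (EFin \o f).
  apply/integrableP; split; first by apply/measurable_EFinP; exact: measurable_funTS.
  by under eq_integral do rewrite abse_EFin; exact: fi.
suff h : mu.-integrable K (EFin \o (fun x => f x * phi x)).
  exact: integrable_patch.
apply: (@integrable_bounded_mul _ _ _ _ (`|M| + 1)) => //.
- by apply: measurable_funTS; exact: continuous_measurable_fun.
- move=> x Kx; apply: (HM (`|M| + 1)); last by exists x.
  by rewrite (le_lt_trans (ler_norm M))// ltrDl.
Qed.

Let derive1_stepB n a b : derive1 (step n a \- step n b) =
  (fun x => derive1 (step n a) x - derive1 (step n b) x).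
Proof.
apply: is_derive_derive1 => x.
by apply: is_deriveB; apply: smooth_is_derive; exact: smooth_step.
Qed.

(** Since 1/(n+1) <= 1, the support lies in one interval for all [n], which supplies the dominating
    function in [Rintegral_stepB_cvg]. *)
Let stepB0 n (a b y : R) : a <= b -> y \notin `]a, b + 1] -> (step n a \- step n b) y = 0.
Proof.
move=> ab; rewrite in_itv/= negb_and -leNgt -ltNge => /orP[ya|yb].
  by rewrite !step0 ?subrr// (le_trans ya).
have n1 : n.+1%:R^-1 <= 1 :> R by rewrite invf_le1// ler1n.
have bn : b + n.+1%:R^-1 <= y by rewrite (le_trans _ (ltW yb))// lerD2l.
by rewrite !step1 ?subrr// (le_trans _ bn)// lerD2r.
Qed.

Let test_stepB n (a b : R) : a <= b -> test_function (step n a \- step n b).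
Proof.
move=> ab; apply: (@test_function_itv _ a (b + 1)).
  by apply: smoothB; exact: smooth_step.
move=> x xab; apply: stepB0 => //; apply: contra xab; exact: subset_itv_oc_cc.
Qed.

Let step_cvg x y : (fun n => step n x y) @ \oo --> ((x < y)%R%:R : R).
Proof.
case: ltP => xy; last first.
  by under eq_fun do rewrite step0//; exact: cvg_cst.
apply: cvg_near_cst; near=> n; rewrite step1// -lerBrDl ltW//; near: n.
have yx : 0 < y - x by rewrite subr_gt0.
exact: (near_infty_natSinv_lt (PosNum yx)).
Unshelve. all: by end_near. Qed.

Let Rintegral_stepB_cvg g (a b : R) : a <= b -> locally_integrable setT g ->
  (fun n => \int[mu]_x (g x * (step n a \- step n b) x)) @ \oo -->
  \int[mu]_(x in `[a, b]) g x.
Proof.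
move=> ab lg.
have [mg _ _] := lg.
have ms n : measurable_fun setT (step n a \- step n b).
  apply: continuous_measurable_fun; apply: smooth_continuous.
  by apply: smoothB; exact: smooth_step.
have gi : mu.-integrable `]a, b] (EFin \o g).
  apply: (integrableS _ _ _ (@locally_integrable_itv _ _ a b lg)) => //.
  exact: subset_itv_oc_cc.
(* The pointwise limit of the smoothed indicators is the indicator of the half-open interval,
   because [step n x] vanishes at [x] itself; the missing endpoint does not change the integral. *)
have LE : (fun x => g x * ((a < x)%R%:R - (b < x)%R%:R)) = g \_ `]a, b].
  apply: funext => x; rewrite patchE mem_setE in_itv/=.
  case: (leP x b) => xb; rewrite ?andbT ?andbF; case: (ltP a x) => ax.
  - by rewrite subr0 mulr1.
  - by rewrite subrr mulr0.
  - by rewrite subrr mulr0.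
  - by have := lt_le_trans (le_lt_trans ax (le_lt_trans ab xb)) (lexx x); rewrite ltxx.
have -> : \int[mu]_(x in `[a, b]) g x =
    fine (\int[mu]_x (g x * ((a < x)%R%:R - (b < x)%R%:R))%:E).
  rewrite -(Rintegral_itv_obnd_cbnd gi) Rintegral_mkcond.
  by apply: eq_Rintegral => x _; rewrite -LE.
have Li : mu.-integrable setT (EFin \o (fun x => g x * ((a < x)%R%:R - (b < x)%R%:R))).
  by rewrite LE; exact: integrable_patch.
apply: fine_cvg; rewrite fineK; last by apply: integrable_fin_num Li.
have and33 (A B C : Prop) : [/\ A, B & C] -> C by case.
apply: (and33 _ _ _ (@dominated_convergence _ _ R mu setT measurableT
  (fun n x => (g x * (step n a \- step n b) x)%:E)
  (fun x => (g x * ((a < x)%R%:R - (b < x)%R%:R))%:E)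
  (EFin \o ((fun x => `|g x|) \_ `[a, b + 1])) _ _ _ _ _)).
- by move=> n; apply/measurable_EFinP; apply: measurable_funM; [exact: mg|exact: ms].
- by case/integrableP : Li.
- apply: aeW => x _; apply: cvg_EFin; first exact: nearW.
  by apply: cvgM; [exact: cvg_cst|apply: cvgB; exact: step_cvg].
- apply: integrable_patch => //; apply: integrable_norm.
  exact: locally_integrable_itv.
- apply: aeW => x n _; rewrite /= lee_fin patchE.
  case: ifPn => [_|]; last first.
    rewrite mem_setE => xab; have /= -> := @stepB0 n a b x ab; first by rewrite mulr0 normr0.
    by apply: contra xab; exact: subset_itv_oc_cc.
  rewrite normrM ler_piMr// !stepE.
  have /andP[? ?] := H01 (n.+1%:R * (x - a)).
  have /andP[? ?] := H01 (n.+1%:R * (x - b)).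
  by rewrite ler_norml; apply/andP; split; lra.
Qed.

(* The test functions are smoothed indicators of [a, b]: their derivatives are
   differences of mollifiers at a and at b. *)
Lemma weak_derivative_Rintegral f g (a b : R) : weak_derivative 1 f g ->
  lebesgue_pt f a -> lebesgue_pt f b -> a <= b ->
  f b - f a = \int[mu]_(x in `[a, b]) g x.
Proof.
move=> [lf lg fg] fa fb ab.
have h1 : (fun n => \int[mu]_x (f x * derive1 (step n b) x) -
    \int[mu]_x (f x * derive1 (step n a) x)) @ \oo --> f b - f a.
  by apply: cvgB; exact: mollify.
apply: cvg_unique h1 _ => //.
rewrite (_ : (fun n => _) = (fun n => \int[mu]_x (g x * (step n a \- step n b) x))).
  exact: Rintegral_stepB_cvg.
apply: funext => n.
have := fg _ (test_stepB n ab); rewrite derive1n1 derive1_stepB expr1 mulN1r.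
move=> /(congr1 -%R); rewrite opprK => <-.
rewrite -RintegralB//; try exact: integrable_mul_test_function.
rewrite -[RHS]mulN1r -RintegralZl//.
  by apply: eq_Rintegral => x _; ring.
apply: integrable_mul_test_function => //.
have := test_function_derive1 (test_stepB n ab); rewrite derive1_stepB; exact.
Qed.
End weak_derivatives.

(** * Primitives of locally integrable functions *)

Section primitives.
Set Implicit Arguments.
Unset Strict Implicit.
Context {R : realType}.
Local Notation mu := (@lebesgue_measure R).
Implicit Types (f g F G : R -> R) (a b : R).

Lemma ae_exists_itv (P : R -> Prop) a b : {ae mu, forall x, P x} -> a < b ->
  exists2 x, x \in `]a, b[ & P x.
Proof.
move=> [N [mN N0 PN]] ab; apply: contrapT => nP.
have : (mu `]a, b[ <= mu N)%E.
  apply: le_measure; rewrite ?inE//.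
  by move=> x /= xab; apply: PN => /= Px; apply: nP; exists x.
rewrite N0 lebesgue_measure_itv/= lte_fin ab -EFinD lee_fin.
by rewrite leNgt subr_gt0 ab.
Qed.

Lemma ae_eq_continuous f g : continuous f -> continuous g ->
  {ae mu, forall x, f x = g x} -> f = g.
Proof.
move=> cf cg fg; apply: funext => x; apply/eqP; rewrite -subr_eq0.
apply/negPn/negP => fgx.
have cfg : {for x, continuous (f \- g)} by apply: continuousB; [exact: cf|exact: cg].
have : \forall y \near x, f y - g y != 0.
  have := cfg; rewrite /prop_for /continuous_at => /cvgr_neq0; apply; exact: fgx.
move=> /nbhs_ballP[d /= d0 xd].
have [y yd fgy] := @ae_exists_itv _ (x - d) (x + d) fg ltac:(lra).
have /xd : ball x d y by rewrite ball_itv.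
by rewrite fgy subrr eqxx.
Qed.

Lemma small_Rintegral_itv g a b e : locally_integrable setT g -> 0 < e ->
  exists2 d, 0 < d & forall x y, a <= x -> x <= y -> y <= b -> y - x < d ->
    \int[mu]_(t in `[x, y]) `|g t| < e.
Proof.
move=> lg e0.
have := integrable_patch (measurable_itv _) (@locally_integrable_itv _ _ a b lg).
move=> /integral_normr_continuous /(_ _ e0)[d [d0 dg]].
exists d => // x y ax xy yb yxd.
have : (mu `[x, y] < d%:E)%E.
  by rewrite lebesgue_measure_itv/= lte_fin; case: ifPn; rewrite ?lte_fin.
move=> /(dg _ (measurable_itv _)); apply: le_lt_trans.
rewrite le_eqVlt; apply/orP; left; apply/eqP; apply: eq_Rintegral => t.
rewrite inE/= in_itv/= => /andP[xt ty]; rewrite patchE ifT// inE/= in_itv/=.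
by rewrite (le_trans ax)// (le_trans ty).
Qed.

(** This is local absolute continuity of [F] with almost-everywhere derivative [g]. The integral
    form needs no pointwise derivative and is insensitive to changing [g] on a null set, as suits a
    weak derivative. *)
Definition primitive F g := locally_integrable setT g /\
  forall a b, a <= b -> F b - F a = \int[mu]_(x in `[a, b]) g x.

Lemma primitive_locally_integrable F g : primitive F g -> locally_integrable setT g.
Proof. by case. Qed.

Lemma primitive_dist F g x y : primitive F g -> x <= y ->
  `|F y - F x| <= \int[mu]_(t in `[x, y]) `|g t|.
Proof.
move=> [lg Fg] xy; rewrite Fg//.
by apply: le_normr_Rintegral => //; exact: locally_integrable_itv.
Qed.

Lemma primitive_unif_continuous F g a b e : primitive F g -> 0 < e ->
  exists2 d, 0 < d & forall x y, a <= x -> x <= y -> y <= b -> y - x < d ->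
    `|F y - F x| < e.
Proof.
move=> Fg e0; have [d d0 dg] := @small_Rintegral_itv g a b _ (primitive_locally_integrable Fg) e0.
exists d => // x y ax xy yb yxd; apply: le_lt_trans (primitive_dist Fg xy) _.
exact: dg.
Qed.

Lemma primitive_continuous F g : primitive F g -> continuous F.
Proof.
move=> Fg x; apply/cvgrPdist_lt => e e0.
have [d d0 dF] := @primitive_unif_continuous F g (x - 1) (x + 1) _ Fg e0.
near=> y.
have : `|y - x| < Num.min 1 d.
  rewrite distrC; near: y; apply/nbhs_ballP; exists (Num.min 1 d) => //=.
  by rewrite lt_min ltr01.
rewrite lt_min => /andP[]; rewrite ltr_norml => /andP[? ?].
rewrite ltr_norml => /andP[? ?].
have [xy|/ltW yx] := leP x y.
  by rewrite distrC; apply: dF; lra.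
by apply: dF; lra.
Unshelve. all: by end_near. Qed.

Lemma primitive_is_derive F g : primitive F g -> continuous g ->
  forall x : R, is_derive x (1 : R) F (g x).
Proof.
move=> [lg Fg] cg x.
have xu : x < x + 1 by rewrite ltrDl.
have ax : x - 1 < x by rewrite ltrBlDr ltrDl.
have [dF dFE] := continuous_FTC1_closed xu (@locally_integrable_itv _ _ _ _ lg) ax (cg x).
apply: (@near_eq_is_derive R R R (cst (F (x - 1)) + (fun y => \int[mu]_(t in `[x - 1, y]) g t))).
  near=> y; rewrite addrfctE /= -Fg; first by rewrite addrC subrK.
  by apply: ltW; near: y; exact: lt_nbhsr.
rewrite -[g x]add0r; apply: is_deriveD.
by split; [exact: dF|rewrite -derive1E].
Unshelve. all: by end_near. Qed.

Lemma primitive_ae F g h : primitive F g -> locally_integrable setT h ->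
  {ae mu, forall x, g x = h x} -> primitive F h.
Proof.
move=> [lg Fg] lh gh; split => // a b ab; rewrite Fg//.
congr fine; apply: ae_eq_integral => //.
- by apply/measurable_EFinP; apply: measurable_funTS; case: lg.
- by apply/measurable_EFinP; apply: measurable_funTS; case: lh.
- by apply: ae_mono gh => x ->.
Qed.

Lemma weak_derivative_primitive f g : weak_derivative 1 f g ->
  exists2 F, primitive F g & {ae mu, forall x, f x = F x}.
Proof.
move=> fg; have [lf lg _] := fg.
have L := lebesgue_differentiation lf.
(* The primitive is anchored at a Lebesgue point [c] of [f], with value [f c]; it then agrees with
   [f] at every Lebesgue point. *)
have [c _ cf] := ae_exists_itv L (@ltr01 R).
exists (fun x => f c + (if c <= x then \int[mu]_(t in `[c, x]) g t
   else - \int[mu]_(t in `[x, c]) g t)); last first.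
  apply: ae_mono L => x fx; case: leP => [cx|/ltW xc].
    by rewrite -(weak_derivative_Rintegral fg cf fx cx) addrC subrK.
  by rewrite -(weak_derivative_Rintegral fg fx cf xc); ring.
split => // a b ab; have I x y := @locally_integrable_itv _ _ x y lg.
case: (leP c a) => [ca|/ltW ac].
  by rewrite (le_trans ca ab) (Rintegral_itv_chasles ca ab (I _ _)); ring.
case: (leP c b) => [cb|/ltW bc].
  by rewrite (Rintegral_itv_chasles ac cb (I _ _)); ring.
by rewrite (Rintegral_itv_chasles ab bc (I _ _)); ring.
Qed.

Lemma weak_derivative_continuous_primitive f g : continuous f ->
  weak_derivative 1 f g -> primitive f g.
Proof.
move=> cf fg; have [F Fg fF] := weak_derivative_primitive fg.
by rewrite (ae_eq_continuous cf (primitive_continuous Fg) fF).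
Qed.

(** [sobolev] asks for each weak derivative directly from [f]. Testing with phi' links two
    consecutive ones, so that first-order results can be iterated. *)
Lemma weak_derivativeS j f g h : weak_derivative j f g ->
  weak_derivative j.+1 f h -> weak_derivative 1 g h.
Proof.
move=> [_ lg fg] [_ lh fh]; split => // phi tphi.
have := fg _ (test_function_derive1 tphi).
rewrite -derive1Sn fh// exprS -mulrA mulrCA => /(mulfI (lreg_neq0 (@lreg_sign _ j))).
by rewrite derive1n1 expr1.
Qed.

End primitives.

(** * Chain rule for absolutely continuous functions *)

Section chain_rule.
Set Implicit Arguments.
Unset Strict Implicit.
Context {R : realType}.
Local Notation mu := (@lebesgue_measure R).
Implicit Types (f g h F G : R -> R) (a b : R).

Lemma locally_integrableP f : measurable_fun setT f ->
  (forall a b, mu.-integrable `[a, b] (EFin \o f)) -> locally_integrable setT f.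
Proof.
move=> mf fi; split => //; first exact: openT.
move=> K _ cK; have [M [_ HM]] := compact_bounded cK.
have KM : K `<=` `[- (`|M| + 1), `|M| + 1].
  move=> x Kx /=; rewrite in_itv/= -ler_norml; apply: (HM (`|M| + 1)) => //.
  by rewrite (le_lt_trans (ler_norm M))// ltrDl.
have mK : measurable K by exact: compact_measurable.
have /integrableP[_] : mu.-integrable K (EFin \o f).
  have fM := fi (- (`|M| + 1)) (`|M| + 1).
  by apply: integrableS fM.
by under eq_integral do rewrite abse_EFin.
Qed.

Lemma continuous_itv_bounded h a b : continuous h ->
  exists K, forall x, x \in `[a, b] -> `|h x| <= K.
Proof.
move=> ch.
have [M [_ HM]] := compact_bounded (continuous_compact (continuous_subspaceT ch) (@segment_compact R a b)).
exists (`|M| + 1) => x xab; apply: (HM (`|M| + 1)); last by exists x.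
by rewrite (le_lt_trans (ler_norm M))// ltrDl.
Qed.

Lemma locally_integrableM f h : locally_integrable setT f -> continuous h ->
  locally_integrable setT (fun x => f x * h x).
Proof.
move=> lf ch; have mh := continuous_measurable_fun ch; have [mf _ _] := lf.
apply: locally_integrableP; first exact: measurable_funM.
move=> a b; have [K hK] := @continuous_itv_bounded h a b ch.
apply: (@integrable_bounded_mul _ _ _ _ K) => //; first exact: measurable_funTS.
exact: locally_integrable_itv.
Qed.

Lemma locally_integrableZ f c : locally_integrable setT f ->
  locally_integrable setT (fun x => c * f x).
Proof.
move=> lf; under eq_fun do rewrite mulrC.
by apply: locally_integrableM => //; exact: cst_continuous.
Qed.

Lemma locally_integrable_norm f : locally_integrable setT f ->
  locally_integrable setT (fun x => `|f x|).
Proof.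
move=> lf; have [mf _ _] := lf; apply: locally_integrableP.
  exact: measurableT_comp.
by move=> a b; apply: integrable_norm; exact: locally_integrable_itv.
Qed.

Lemma primitiveD F f G g : primitive F f -> primitive G g ->
  primitive (fun x => F x + G x) (fun x => f x + g x).
Proof.
move=> [lf Ff] [lg Gg]; split; first exact: locally_integrableD.
move=> a b ab; rewrite RintegralD//; try exact: locally_integrable_itv.
by rewrite -Ff// -Gg//; ring.
Qed.

Lemma primitiveZ F f c : primitive F f ->
  primitive (fun x => c * F x) (fun x => c * f x).
Proof.
move=> [lf Ff]; split; first exact: locally_integrableZ.
move=> a b ab; rewrite RintegralZl//; last exact: locally_integrable_itv.
by rewrite -Ff// mulrBr.
Qed.

Lemma primitiveB F f G g : primitive F f -> primitive G g ->
  primitive (fun x => F x - G x) (fun x => f x - g x).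
Proof.
move=> Ff Gg.
have -> : (fun x => F x - G x) = (fun x => F x + (-1) * G x).
  by apply: funext => x; rewrite mulN1r.
have -> : (fun x => f x - g x) = (fun x => f x + (-1) * g x).
  by apply: funext => x; rewrite mulN1r.
by apply: primitiveD => //; exact: primitiveZ.
Qed.

(** Cutting [a, b] into short pieces and adding the bounds gives |D a b| <= e * int w for every e >
    0. This proves an integral identity from a local error estimate, without differentiating almost
    everywhere. *)
Lemma Rintegral_eq_additive (D : R -> R -> R) w a b :
  locally_integrable setT w ->
  (forall x y z, x <= y -> y <= z -> D x z = D x y + D y z) ->
  (forall e, 0 < e -> exists2 d, 0 < d & forall x y, a <= x -> x <= y -> y <= b ->
     y - x < d -> `|D x y| <= e * \int[mu]_(t in `[x, y]) w t) ->
  a <= b -> D a b = 0.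
Proof.
move=> lw DD Dw ab; have I x y := @locally_integrable_itv _ _ x y lw.
suff H e : 0 < e -> `|D a b| <= e * \int[mu]_(t in `[a, b]) w t.
  apply/eqP; rewrite -normr_le0; apply/ler_addgt0Pl => e e0; rewrite addr0.
  set W := \int[mu]_(t in _) _ in H.
  have W1 : 0 < `|W| + 1 by rewrite ltr_wpDl.
  apply: le_trans (H (e / (`|W| + 1)) (divr_gt0 e0 W1)) _.
  rewrite mulrAC ler_pdivrMr// ler_wpM2l ?(ltW e0)//.
  by rewrite (le_trans (ler_norm W))// lerDl.
move=> e0; have [d d0 Dd] := Dw _ e0.
(* Induction on the number of pieces. Their length is d/2 because the local estimate requires length
   strictly below d. *)
have H n : forall y, a <= y -> y <= b -> y - a <= n%:R * (d / 2) ->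
    `|D a y| <= e * \int[mu]_(t in `[a, y]) w t.
  elim: n => [|n IH] y ay yb yn; first by apply: Dd => //; lra.
  have [yd|dy] := ltP (y - a) d; first exact: Dd.
  pose z := y - d / 2.
  have az : a <= z by rewrite /z; lra.
  have zy : z <= y by rewrite /z; lra.
  rewrite (DD _ _ _ az zy) (Rintegral_itv_chasles az zy (I _ _)) mulrDr.
  apply: le_trans (ler_normD _ _) _; apply: lerD.
    apply: IH => //; first by rewrite (le_trans zy).
    by move: yn; rewrite -[n.+1]addn1 natrD mulrDl mul1r /z; lra.
  by apply: Dd => //; rewrite /z; lra.
have d2 : 0 < d / 2 by rewrite divr_gt0.
have nn : 0 <= (b - a) / (d / 2) by rewrite divr_ge0 ?subr_ge0 ?(ltW d2).
have := archi_boundP nn; set n := Num.Def.archi_bound _ => bn.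
by apply: (H n) => //; rewrite -ler_pdivrMr// ltW.
Qed.

Variables (phi dphi : R -> R).

(** A C^1 function with 2-Lipschitz derivative, stated through its Taylor remainder so that it can
    be integrated directly. The constants 1 and 2 are those of x^2, for which both bounds are
    equalities. *)
Definition C11 := (forall x y, `|phi y - phi x - dphi x * (y - x)| <= (y - x) ^+ 2) /\
  (forall x y, `|dphi y - dphi x| <= 2 * `|y - x|).

Hypothesis phi_C11 : C11.

Lemma C11_continuous : continuous dphi.
Proof.
move=> x; apply/cvgrPdist_lt => e e0; near=> y.
rewrite distrC; apply: le_lt_trans (phi_C11.2 x y) _.
rewrite -ltr_pdivlMl// distrC; near: y; apply/nbhs_ballP.
by exists (2^-1 * e) => //=; rewrite mulr_gt0.
Unshelve. all: by end_near. Qed.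

Lemma primitive_comp m n : primitive m n ->
  primitive (phi \o m) (fun x => dphi (m x) * n x).
Proof.
move=> mn; have [ln mnE] := mn; have cm := primitive_continuous mn.
have [C1 C2] := phi_C11.
have cd : continuous (dphi \o m).
  by move=> x; apply: continuous_comp; [exact: cm|exact: C11_continuous].
have lk : locally_integrable setT (fun x => dphi (m x) * n x).
  by under eq_fun do rewrite mulrC; exact: (locally_integrableM ln cd).
split=> // a b ab; apply/eqP; rewrite -subr_eq0; apply/eqP.
apply: (@Rintegral_eq_additive (fun a b => phi (m b) - phi (m a) -
  \int[mu]_(x in `[a, b]) (dphi (m x) * n x)) (fun x => `|n x|) a b) => //.
- exact: locally_integrable_norm.
- move=> x y z xy yz.
  by rewrite (Rintegral_itv_chasles xy yz (@locally_integrable_itv _ _ x z lk)); ring.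
move=> e e0.
have e3 : 0 < e / 3 by rewrite divr_gt0.
have [d d0 dm] := @primitive_unif_continuous _ _ _ a b _ mn e3.
exists d => // x y ax xy yb yxd.
have In : mu.-integrable `[x, y] (EFin \o n) by exact: locally_integrable_itv.
have Ik : mu.-integrable `[x, y] (EFin \o (fun x => dphi (m x) * n x)).
  exact: locally_integrable_itv.
(* The defect on [x, y] is a Taylor remainder minus the oscillation of [dphi \o m] against [n]. When
   [m] varies by less than e/3, the first is at most e/3 and the second at most 2e/3 times the
   integral of |n|. *)
have -> : phi (m y) - phi (m x) - \int[mu]_(t in `[x, y]) (dphi (m t) * n t) =
  (phi (m y) - phi (m x) - dphi (m x) * (m y - m x)) -
  \int[mu]_(t in `[x, y]) ((dphi (m t) - dphi (m x)) * n t).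
  under [in RHS]eq_Rintegral do rewrite mulrBl.
  rewrite RintegralB//; last exact: integrableZ_EFin.
  by rewrite RintegralZl// -mnE//; ring.
have -> : e = e / 3 + 2 * (e / 3) by field.
rewrite mulrDl; apply: le_trans (ler_normB _ _) _; apply: lerD.
  apply: le_trans (C1 _ _) _; rewrite -real_normK ?num_real// expr2.
  apply: ler_pM => //; last exact: primitive_dist.
  by apply/ltW/dm.
rewrite -RintegralZl//; last exact: integrable_norm.
apply: ler_norm_Rintegral => //.
- apply: measurable_funM; apply: measurable_funTS; last by case: ln.
  apply: measurable_funB => //; exact: continuous_measurable_fun.
- move=> t; rewrite /= in_itv/= => /andP[xt ty].
  rewrite normrM ler_wpM2r//; apply: le_trans (C2 _ _) _.
  rewrite ler_wpM2l//; apply/ltW/dm => //; first exact: le_trans yb.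
  by apply: le_lt_trans yxd; rewrite lerB.
- by apply: integrableZ_EFin => //; exact: integrable_norm.
Qed.

End chain_rule.

(** * Square-integrable functions *)

Section square_integrable.
Set Implicit Arguments.
Unset Strict Implicit.
Context {R : realType}.
Local Notation mu := (@lebesgue_measure R).
Implicit Types (f g h F G : R -> R) (a b c : R).

Lemma C11_sqr : @C11 R (fun x => x ^+ 2) (fun x => 2 * x).
Proof.
split=> x y; last by rewrite -mulrBr normrM ger0_norm.
have -> : y ^+ 2 - x ^+ 2 - 2 * x * (y - x) = (y - x) ^+ 2 by ring.
by rewrite ger0_norm// sqr_ge0.
Qed.

Lemma eq_primitive F f G g : F =1 G -> f =1 g -> primitive F f -> primitive G g.
Proof. by move=> /funext -> /funext ->. Qed.

(** By polarization, FG = ((F + G)^2 - F^2 - G^2) / 2, so the product rule is the chain rule for the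
    square. *)
Lemma primitiveM F f G g : primitive F f -> primitive G g ->
  primitive (fun x => F x * G x) (fun x => f x * G x + F x * g x).
Proof.
move=> Ff Gg.
have FG := primitive_comp C11_sqr (primitiveD Ff Gg).
have FF := primitive_comp C11_sqr Ff.
have GG := primitive_comp C11_sqr Gg.
apply: eq_primitive (primitiveZ 2^-1 (primitiveB (primitiveB FG FF) GG)) => x /=.
  by field.
by field.
Qed.

Definition L2 f := measurable_fun setT f /\
  mu.-integrable setT (EFin \o (fun x => f x ^+ 2)).

Definition sqint f := \int[mu]_x (f x ^+ 2).

Lemma sqint_ge0 f : 0 <= sqint f.
Proof. by apply: Rintegral_ge0 => x _; exact: sqr_ge0. Qed.

Lemma normM_leD_sqr (x y : R) : `|x * y| <= x ^+ 2 + y ^+ 2.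
Proof.
have := sqr_ge0 (x + y); have := sqr_ge0 (x - y).
have := sqr_ge0 x; have := sqr_ge0 y.
rewrite sqrrB sqrrD ler_norml -mulr_natr => ? ? ? ?; apply/andP; split; lra.
Qed.

Lemma sqrD_le (x y : R) : (x + y) ^+ 2 <= 2 * (x ^+ 2 + y ^+ 2).
Proof. by have := sqr_ge0 (x - y); rewrite sqrrB sqrrD -mulr_natr; lra. Qed.

Lemma L2_integrableM f g : L2 f -> L2 g ->
  mu.-integrable setT (EFin \o (fun x => f x * g x)).
Proof.
move=> [mf f2] [mg g2].
apply: (@le_integrable_EFin _ _ _ (fun x => f x ^+ 2 + g x ^+ 2)) => //.
- exact: measurable_funM.
- by move=> x _; exact: normM_leD_sqr.
- exact: integrableD_EFin.
Qed.

Lemma L2Z f c : L2 f -> L2 (fun x => c * f x).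
Proof.
move=> [mf f2]; split; first exact: measurable_funM.
under eq_fun do rewrite exprMn.
exact: (integrableZ_EFin (c ^+ 2) measurableT f2).
Qed.

Lemma L2D f g : L2 f -> L2 g -> L2 (fun x => f x + g x).
Proof.
move=> L2f L2g; have [mf f2] := L2f; have [mg g2] := L2g.
split; first exact: measurable_funD.
apply: (@le_integrable_EFin _ _ _ (fun x => 2 * (f x ^+ 2 + g x ^+ 2))) => //.
- by apply: measurable_funX; exact: measurable_funD.
- by move=> x _; rewrite ger0_norm ?sqr_ge0// sqrD_le.
- by apply: integrableZ_EFin => //; exact: integrableD_EFin.
Qed.

Lemma L2B f g : L2 f -> L2 g -> L2 (fun x => f x - g x).
Proof.
move=> L2f L2g; have := L2D L2f (L2Z (-1) L2g).
by under eq_fun do rewrite mulN1r.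
Qed.

Lemma L2_ae f g : L2 f -> measurable_fun setT g ->
  {ae mu, forall x, f x = g x} -> L2 g.
Proof.
move=> [mf /integrableP[mf2 f2]] mg fg; split => //; apply/integrableP; split.
  by apply/measurable_EFinP; exact: measurable_funX.
rewrite (_ : (\int[mu]_x _)%E = (\int[mu]_x `|(f x ^+ 2)%:E|)%E)//.
apply: ae_eq_integral => //.
- by do 2 apply: measurableT_comp => //; exact: measurable_funX.
- by do 2 apply: measurableT_comp => //; exact: measurable_funX.
- by apply: ae_mono fg => x /= ->.
Qed.

Lemma sqint_ae f g : L2 f -> L2 g -> {ae mu, forall x, f x = g x} ->
  sqint f = sqint g.
Proof.
move=> [mf _] [mg _] fg; apply: ae_eq_Rintegral.
- exact: measurable_funX.
- exact: measurable_funX.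
- by apply: ae_mono fg => x ->.
Qed.

Lemma L2_Lfun f : f \in Lfun mu 2%:E -> L2 f.
Proof.
move=> L2f; split; last exact: Lfun2_integrable_sqr.
by move: L2f; rewrite inE => /andP[]; rewrite inE.
Qed.

Lemma sqintD_le f g : L2 f -> L2 g ->
  sqint (fun x => f x + g x) <= 2 * (sqint f + sqint g).
Proof.
move=> L2f L2g; have [mf f2] := L2f; have [mg g2] := L2g.
rewrite /sqint -RintegralD// -RintegralZl//; last exact: integrableD_EFin.
apply: le_Rintegral => //; first by case: (L2D L2f L2g).
  by apply: integrableZ_EFin => //; exact: integrableD_EFin.
by move=> x _; exact: sqrD_le.
Qed.

Lemma sqintB_le f g : L2 f -> L2 g ->
  sqint (fun x => f x - g x) <= 2 * (sqint f + sqint g).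
Proof.
move=> L2f L2g; have := sqintD_le L2f (L2Z (-1) L2g).
rewrite /sqint; under eq_Rintegral do rewrite mulN1r.
by under [X in 2 * (_ + X)]eq_Rintegral do rewrite mulN1r sqrrN.
Qed.

Lemma L2_CauchySchwarz f g : L2 f -> L2 g ->
  \int[mu]_x `|f x * g x| <= Num.sqrt (sqint f) * Num.sqrt (sqint g).
Proof.
move=> L2f L2g; have [mf f2] := L2f; have [mg g2] := L2g.
have fg := integrable_norm (L2_integrableM L2f L2g).
rewrite -sqrtrM ?sqint_ge0//; set B := \int[mu]_x _.
have B0 : 0 <= B by exact: Rintegral_ge0.
rewrite -[B]ger0_norm// -sqrtr_sqr ler_sqrt ?mulr_ge0 ?sqint_ge0//.
(* This quadratic polynomial in [c] is the integral of (c|f| - |g|)^2. The value c = B / sqint f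
   gives the inequality; if sqint f = 0 the polynomial is affine and c = (sqint g + 1) / B would
   make it negative unless B = 0. *)
have H c : 0 <= c ^+ 2 * sqint f + sqint g - 2 * c * B.
  rewrite /sqint /B -!RintegralZl//.
  rewrite -RintegralD//; last exact: integrableZ_EFin.
  rewrite -RintegralB//; last 2 first.
    by apply: integrableD_EFin => //; exact: integrableZ_EFin.
    exact: integrableZ_EFin.
  apply: Rintegral_ge0 => x _; rewrite normrM.
  have -> : c ^+ 2 * f x ^+ 2 + g x ^+ 2 - 2 * c * (`|f x| * `|g x|) =
      (c * `|f x| - `|g x|) ^+ 2.
    by rewrite -[f x ^+ 2]real_normK ?num_real// -[g x ^+ 2]real_normK ?num_real//; ring.
  exact: sqr_ge0.
have [f0|f0] := eqVneq (sqint f) 0.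
  have [->|B0'] := eqVneq B 0; first by rewrite expr0n f0 mul0r.
  have := H ((sqint g + 1) / B); rewrite f0 mulr0 add0r -mulrA divfK//.
  have := sqint_ge0 g; lra.
have f0' : 0 < sqint f by rewrite lt_def f0 sqint_ge0.
have := H (B / sqint f); rewrite -[leLHS](mulr0 (sqint f)^-1).
have -> : (B / sqint f) ^+ 2 * sqint f + sqint g - 2 * (B / sqint f) * B =
  (sqint f)^-1 * (sqint f * sqint g - B ^+ 2) by field.
by rewrite ler_pM2l ?invr_gt0// subr_ge0.
Qed.

(* Integrate (f^2)' = 2 f g from x to y and average over y in [x, x + 1]. *)
Lemma primitive_sup_bound f g x : primitive f g -> L2 f -> L2 g ->
  f x ^+ 2 <= 2 * (sqint f + sqint g).
Proof.
move=> fg L2f L2g; have [mf f2] := L2f; have [mg g2] := L2g.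
have I2 : mu.-integrable setT (EFin \o (fun t => f t ^+ 2 + g t ^+ 2)).
  exact: integrableD_EFin.
have I1 : mu.-integrable setT (EFin \o (fun t => 2 * f t * g t)).
  under eq_fun do rewrite -mulrA.
  exact: (integrableZ_EFin 2 measurableT (L2_integrableM L2f L2g)).
have H y : x <= y -> f x ^+ 2 <= f y ^+ 2 + (sqint f + sqint g).
  move=> xy; have := primitive_dist (primitive_comp C11_sqr fg) xy => /= h.
  have := ler_norm (f x ^+ 2 - f y ^+ 2); rewrite distrC => /le_trans/(_ h) {}h.
  rewrite -lerBlDl; apply: le_trans h _.
  rewrite /sqint -RintegralD//.
  apply: (@le_trans _ _ (\int[mu]_(t in `[x, y]) (f t ^+ 2 + g t ^+ 2))).
    apply: le_Rintegral => //.
    - by apply: integrable_norm; exact: integrableS I1.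
    - exact: integrableS I2.
    - move=> t _; rewrite -mulrA normrM ger0_norm//.
      have := sqr_ge0 (`|f t| - `|g t|); rewrite sqrrB normrM !real_normK ?num_real//.
      rewrite -mulr_natr; lra.
  by apply: ler_Rintegral_subset => // t _; rewrite addr_ge0 ?sqr_ge0.
have x1 : x <= x + 1 by rewrite lerDl.
have c1 c : \int[mu]_(t in `[x, x + 1]) c = c.
  rewrite Rintegral_cst// [X in fine X](_ : _ = 1%:E) ?mulr1//.
  transitivity (mu `[x, x + 1]); first by [].
  rewrite lebesgue_measure_itv/= lte_fin ltrDl ltr01 -EFinD; congr EFin.
  by ring.
have ci c : mu.-integrable `[x, x + 1] (EFin \o (fun=> c)).
  by apply: locally_integrable_itv; apply: continuous_locally_integrable; exact: cst_continuous.
rewrite -(c1 (f x ^+ 2)).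
apply: (@le_trans _ _ (\int[mu]_(t in `[x, x + 1]) (f t ^+ 2 + (sqint f + sqint g)))).
  apply: le_Rintegral => //.
  - by apply: integrableD_EFin => //; exact: integrableS f2.
  - by move=> t; rewrite /= in_itv/= => /andP[xt _]; exact: H.
rewrite RintegralD//; last exact: integrableS f2.
rewrite c1.
have : \int[mu]_(t in `[x, x + 1]) (f t ^+ 2) <= sqint f.
  by apply: ler_Rintegral_subset => // t _; exact: sqr_ge0.
move=> /(lerD)/(_ (lexx (sqint f + sqint g)))/le_trans; apply.
by move: (sqint_ge0 g); clear; move: (sqint f) (sqint g) => p q; lra.
Qed.

End square_integrable.

(** * The energy *)

Section energy.
Set Implicit Arguments.
Unset Strict Implicit.
Context {R : realType}.
Local Notation mu := (@lebesgue_measure R).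
Implicit Types (f g h F G : R -> R) (a b c : R).

Lemma integrable_small_itv f a b e : mu.-integrable setT (EFin \o f) -> 0 < e ->
  \int[mu]_x `|f x| < e * (b - a) -> exists2 x, x \in `[a, b] & `|f x| < e.
Proof.
move=> fi e0 fe; apply: contrapT => nf.
have fe' x : x \in `[a, b] -> e <= `|f x|.
  by move=> xab; rewrite leNgt; apply/negP => fx; apply: nf; exists x.
have nfi := integrable_norm fi.
have ab : a < b.
  rewrite -subr_gt0 -(pmulr_rgt0 _ e0); apply: le_lt_trans fe.
  exact: Rintegral_ge0.
move: fe; apply/negP; rewrite -leNgt.
have mab : fine (mu `[a, b]) = b - a.
  by rewrite lebesgue_measure_itv/= lte_fin ab -EFinD.
have -> : e * (b - a) = \int[mu]_(x in `[a, b]) e.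
  by rewrite Rintegral_cst// -mab.
apply: (@le_trans _ _ (\int[mu]_(x in `[a, b]) `|f x|)).
  apply: le_Rintegral => //.
  - by apply: locally_integrable_itv; apply: continuous_locally_integrable; exact: cst_continuous.
  - exact: integrableS nfi.
by apply: ler_Rintegral_subset.
Qed.

Lemma Rintegral_itv_cvg f (y x : nat -> R) : mu.-integrable setT (EFin \o f) ->
  (forall n, y n <= - n%:R) -> (forall n, n%:R <= x n) ->
  (fun n => \int[mu]_(t in `[y n, x n]) f t) @ \oo --> \int[mu]_t f t.
Proof.
move=> fi yn xn.
have mf : measurable_fun setT f by apply/measurable_EFinP; case/integrableP : fi.
under eq_fun do rewrite Rintegral_mkcond.
apply: fine_cvg; rewrite fineK; last by apply: integrable_fin_num fi.
have and33 (A B C : Prop) : [/\ A, B & C] -> C by case.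
apply: (and33 _ _ _ (@dominated_convergence _ _ R mu setT measurableT
  (fun n t => ((f \_ `[y n, x n]) t)%:E) (EFin \o f)
  (EFin \o (fun t => `|f t|)) _ _ _ _ _)).
- move=> n; apply/measurable_EFinP; apply/(measurable_restrictT _ _).1 => //.
  exact: measurable_funTS.
- exact/measurable_EFinP.
- apply: aeW => t _; apply: cvg_near_cst; near=> n.
  rewrite patchE ifT// inE/= in_itv/=.
  have : `|t| <= n%:R.
    near: n; exact: nbhs_infty_ger.
  rewrite ler_norml => /andP[tn nt].
  by rewrite (le_trans (yn n))// (le_trans nt).
- exact: integrable_norm.
- apply: aeW => t n _; rewrite /= lee_fin patchE; case: ifPn => _ //.
  by rewrite normr0.
Unshelve. all: by end_near. Qed.

(** Integrability of [F] forces small values arbitrarily far out on both sides. Along such endpoints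
    F(x_n) - F(y_n) tends to 0, while the integrals of [f] between them tend to the full
    integral. *)
Lemma Rintegral_primitive0 F f : primitive F f ->
  mu.-integrable setT (EFin \o F) -> mu.-integrable setT (EFin \o f) ->
  \int[mu]_x f x = 0.
Proof.
move=> [_ Ff] FI fI.
set W := \int[mu]_t `|F t|.
have W0 : 0 <= W by exact: Rintegral_ge0.
(* Times the threshold 1/(n+1), the length (n+1)(W+1) gives W + 1, which exceeds the integral W of
   |F|. *)
have small n a : exists2 x, x \in `[a, a + n.+1%:R * (W + 1)] & `|F x| < n.+1%:R^-1.
  apply: integrable_small_itv => //.
  by rewrite addrAC subrr add0r mulKf// ltrDl.
have /choice[x xP] : forall n, exists x, n%:R <= x /\ `|F x| < n.+1%:R^-1.
  move=> n; have [x] := small n n%:R.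
  by rewrite in_itv/= => /andP[nx _] Fx; exists x.
have /choice[y yP] : forall n, exists y, y <= - n%:R /\ `|F y| < n.+1%:R^-1.
  move=> n; have [y] := small n (- n%:R - n.+1%:R * (W + 1)).
  by rewrite subrK in_itv/= => /andP[_ ny] Fy; exists y.
have yn n : y n <= - n%:R by case: (yP n).
have xn n : n%:R <= x n by case: (xP n).
apply: cvg_unique (Rintegral_itv_cvg fI yn xn) _ => //.
have -> : (fun n => \int[mu]_(t in `[y n, x n]) f t) = (fun n => F (x n) - F (y n)).
  apply: funext => n; rewrite Ff//.
  by rewrite (le_trans (yn n))// (le_trans _ (xn n))// (@le_trans _ _ 0)// oppr_le0.
apply/cvgr0Pnorm_lt => e e0.
have e2 : 0 < e / 2 by rewrite divr_gt0.
near=> n; apply: le_lt_trans (ler_normB _ _) _.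
have : n.+1%:R^-1 < e / 2.
  near: n; exact: (near_infty_natSinv_lt (PosNum e2)).
move=> ne; rewrite [e]splitr; apply: ltrD.
  by apply: lt_trans ne; case: (xP n).
by apply: lt_trans ne; case: (yP n).
Unshelve. all: by end_near. Qed.

Variables (phi dphi : R -> R).
Hypothesis phi_C11 : C11 phi dphi.
Hypothesis phi0 : phi 0 = 0.
Hypothesis dphi0 : dphi 0 = 0.

Lemma dphi_le x : `|dphi x| <= 2 * `|x|.
Proof. by have := phi_C11.2 0 x; rewrite dphi0 !subr0. Qed.

Lemma phi_le x : `|phi x| <= x ^+ 2.
Proof. by have := phi_C11.1 0 x; rewrite phi0 dphi0 !subr0 mul0r subr0. Qed.

Lemma measurable_dphi : measurable_fun setT dphi.
Proof. by apply: continuous_measurable_fun; exact: C11_continuous phi_C11. Qed.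

Lemma continuous_phi : continuous phi.
Proof.
move=> x; apply/cvgrPdist_lt => e e0.
have K0 : 0 < `|dphi x| + 1 by rewrite ltr_wpDl.
pose d := Num.min 1 (e / (`|dphi x| + 1)).
have d0 : 0 < d by rewrite lt_min ltr01 divr_gt0.
near=> y; have : `|x - y| < d.
  by near: y; apply/nbhs_ballP; exists d.
rewrite lt_min ltr_pdivlMr// => /andP[xy1 xye]; apply: le_lt_trans xye.
rewrite distrC -[phi y - phi x](subrK (dphi x * (y - x))).
apply: le_trans (ler_normD _ _) _.
rewrite [leRHS]mulrDr mulr1 [leLHS]addrC; apply: lerD; first by rewrite normrM mulrC distrC.
apply: le_trans (phi_C11.1 x y) _.
by rewrite -real_normK ?num_real// distrC expr2 ler_piMl// ltW.
Unshelve. all: by end_near. Qed.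

Lemma measurable_phi : measurable_fun setT phi.
Proof. by apply: continuous_measurable_fun; exact: continuous_phi. Qed.

Lemma L2_dphi f : L2 f -> L2 (dphi \o f).
Proof.
move=> [mf f2].
have mdf : measurable_fun setT (dphi \o f) by apply: measurableT_comp => //; exact: measurable_dphi.
split => //; apply: (@le_integrable_EFin _ _ _ (fun x => 4 * f x ^+ 2)) => //.
- exact: measurable_funX.
- move=> x _; rewrite normrX /=.
  apply: (@le_trans _ _ ((2 * `|f x|) ^+ 2)); first by rewrite lerXn2r ?nnegrE ?mulr_ge0// dphi_le.
  by rewrite exprMn real_normK ?num_real// -natrX.
- exact: integrableZ_EFin.
Qed.

Lemma integrable_phi f : L2 f -> mu.-integrable setT (EFin \o (phi \o f)).
Proof.
move=> [mf f2]; apply: (@le_integrable_EFin _ _ _ (fun x => f x ^+ 2)) => //.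
- by apply: measurableT_comp => //; exact: measurable_phi.
- by move=> x _; exact: phi_le.
Qed.

Definition energy f := \int[mu]_x phi (f x).

(** Integration by parts on the line: u phi(m) is integrable with integrable derivative v phi(m) + u
    phi'(m) n, so that derivative has integral 0. *)
Lemma energy_transport u v m n Ku Kv :
  primitive u v -> primitive m n -> continuous v ->
  (forall x, `|u x| <= Ku) -> (forall x, `|v x| <= Kv) -> L2 m -> L2 n ->
  \int[mu]_x (dphi (m x) * (u x * n x)) = - \int[mu]_x (v x * phi (m x)).
Proof.
move=> uv mn cv uK vK L2m L2n.
have cu := primitive_continuous uv.
have mu_ := continuous_measurable_fun cu.
have mv := continuous_measurable_fun cv.
have P := primitiveM uv (primitive_comp phi_C11 mn).
have I0 : mu.-integrable setT (EFin \o (fun x => u x * phi (m x))).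
  under eq_fun do rewrite mulrC.
  by apply: (@integrable_bounded_mul _ _ _ _ Ku) => //; exact: integrable_phi.
have I1 : mu.-integrable setT (EFin \o (fun x => v x * phi (m x))).
  under eq_fun do rewrite mulrC.
  by apply: (@integrable_bounded_mul _ _ _ _ Kv) => //; exact: integrable_phi.
have I2 : mu.-integrable setT (EFin \o (fun x => u x * (dphi (m x) * n x))).
  under eq_fun do rewrite mulrC.
  apply: (@integrable_bounded_mul _ _ _ _ Ku) => //.
  by apply: L2_integrableM => //; exact: L2_dphi.
have := Rintegral_primitive0 P I0 (integrableD_EFin measurableT I1 I2).
rewrite RintegralD// => /eqP; rewrite addrC addr_eq0 => /eqP <-.
by apply: eq_Rintegral => x _; ring.
Qed.

End energy.

(** * Continuity and differentiability of the energy along curves in L^2 *)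

Section energy_in_time.
Set Implicit Arguments.
Unset Strict Implicit.
Context {R : realType}.
Local Notation mu := (@lebesgue_measure R).
Implicit Types (f g h F : R -> R) (a b c t : R).

Variables (phi dphi : R -> R).
Hypothesis phi_C11 : C11 phi dphi.
Hypothesis phi0 : phi 0 = 0.
Hypothesis dphi0 : dphi 0 = 0.

Lemma energy_taylor f g : L2 f -> L2 g ->
  `|energy phi g - energy phi f - \int[mu]_x (dphi (f x) * (g x - f x))| <=
  sqint (fun x => g x - f x).
Proof.
move=> L2f L2g; have L2gf := L2B L2g L2f.
have If := integrable_phi phi_C11 phi0 dphi0 L2f.
have Ig := integrable_phi phi_C11 phi0 dphi0 L2g.
have Id := L2_integrableM (L2_dphi phi_C11 dphi0 L2f) L2gf.
rewrite /energy -RintegralB// -RintegralB//; last exact: integrableB_EFin.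
apply: ler_norm_Rintegral => //.
- apply/measurable_EFinP.
  by case/integrableP: (integrableB_EFin measurableT (integrableB_EFin measurableT Ig If) Id).
- by move=> x _; exact: phi_C11.1.
- by case: L2gf.
Qed.

Lemma dphi_pairing_le f g : L2 f -> L2 g ->
  `|\int[mu]_x (dphi (f x) * g x)| <= Num.sqrt (sqint (dphi \o f)) * Num.sqrt (sqint g).
Proof.
move=> L2f L2g; have L2d := L2_dphi phi_C11 dphi0 L2f.
apply: le_trans (L2_CauchySchwarz L2d L2g).
by apply: le_normr_Rintegral => //; exact: L2_integrableM L2d L2g.
Qed.

(** The filter stays general because it is used both with neighbourhoods and with punctured
    neighbourhoods of [t] inside the lifetime, which are one-sided at t = 0. *)
Variables (G : set_system R) (FG : Filter G).

Lemma cvg_sqrt0 (q : R -> R) : q s @[s --> G] --> (0 : R) ->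
  Num.sqrt (q s) @[s --> G] --> (0 : R).
Proof.
by move=> q0; rewrite -(sqrtr0 R); apply: (cvg_comp q _ q0); exact: sqrt_continuous.
Qed.

Lemma energy_cvg (m : R -> R -> R) m0 : L2 m0 -> (\forall s \near G, L2 (m s)) ->
  sqint (fun x => m s x - m0 x) @[s --> G] --> (0 : R) ->
  energy phi (m s) @[s --> G] --> energy phi m0.
Proof.
move=> L20 L2m q0.
set K := Num.sqrt (sqint (dphi \o m0)).
pose q s := sqint (fun x => m s x - m0 x).
have B0 : K * Num.sqrt (q s) + q s @[s --> G] --> (0 : R).
  rewrite -[X in _ --> X](addr0 0); apply: cvgD => //.
  by rewrite -[X in _ --> X](mulr0 K); apply: cvgM; [exact: cvg_cst|exact: cvg_sqrt0].
apply/cvgrPdist_le => e e0; move/cvgr0Pnorm_le : B0 => /(_ _ e0) B0.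
near=> s; have L2s : L2 (m s) by near: s.
rewrite distrC; apply: (@le_trans _ _ `|K * Num.sqrt (q s) + q s|); last by near: s.
rewrite [leRHS]ger0_norm ?addr_ge0 ?mulr_ge0 ?sqrtr_ge0 ?sqint_ge0//.
rewrite -[energy phi (m s) - _](subrK (\int[mu]_x (dphi (m0 x) * (m s x - m0 x)))).
rewrite [leRHS]addrC; apply: le_trans (ler_normD _ _) _; apply: lerD.
  exact: energy_taylor.
by apply: dphi_pairing_le => //; exact: L2B.
Unshelve. all: by end_near. Qed.

(** Write m(s) - m(t) = (s - t)(mt + r(s)) with r(s) tending to 0 in L^2. Dividing the Taylor
    estimate by s - t leaves two errors: the pairing of phi'(m(t)) with r(s), handled by
    Cauchy-Schwarz, and |s - t| times the bounded quantity 2(sqint mt + sqint r(s)). *)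
Lemma energy_quotient_cvg (m : R -> R -> R) t mt : G --> t ->
  (\forall s \near G, s != t) -> (\forall s \near G, L2 (m s)) ->
  L2 (m t) -> L2 mt ->
  sqint (fun x => (m s x - m t x) / (s - t) - mt x) @[s --> G] --> (0 : R) ->
  (energy phi (m s) - energy phi (m t)) / (s - t) @[s --> G] -->
    \int[mu]_x (dphi (m t x) * mt x).
Proof.
move=> Gt Gneq L2m L2t L2mt q0.
set K := Num.sqrt (sqint (dphi \o m t)).
pose r s x := (m s x - m t x) / (s - t) - mt x.
pose q s := sqint (r s).
have B0 : K * Num.sqrt (q s) + `|s - t| * (2 * (sqint mt + q s)) @[s --> G] --> (0 : R).
  rewrite -[X in _ --> X](addr0 0); apply: cvgD => //.
    by rewrite -[X in _ --> X](mulr0 K); apply: cvgM; [exact: cvg_cst|exact: cvg_sqrt0].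
  rewrite -(mul0r (2 * (sqint mt + 0))); apply: cvgM.
    rewrite -(normr0 R) -[in X in _ --> X](subrr t).
    by apply: cvg_norm; apply: cvgB => //; exact: cvg_cst.
  by apply: cvgM; [exact: cvg_cst|apply: cvgD => //; exact: cvg_cst].
apply/cvgrPdist_le => e e0; move/cvgr0Pnorm_le : B0 => /(_ _ e0) B0.
near=> s; have L2s : L2 (m s) by near: s.
have st : s - t != 0 by rewrite subr_eq0; near: s.
have L2r : L2 (r s).
  apply: L2B => //; rewrite (_ : (fun x => _) = (fun x => (s - t)^-1 * (m s x - m t x))).
    by apply: L2Z; exact: L2B.
  by apply: funext => x; rewrite mulrC.
rewrite distrC; apply: (@le_trans _ _ `|K * Num.sqrt (q s) + `|s - t| * (2 * (sqint mt + q s))|); last by near: s.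
rewrite [leRHS]ger0_norm ?addr_ge0 ?mulr_ge0 ?addr_ge0 ?sqrtr_ge0 ?sqint_ge0//.
have mE x : m s x - m t x = (s - t) * (mt x + r s x).
  by rewrite /r addrCA subrr addr0 mulrC divfK.
have L2d := L2_dphi phi_C11 dphi0 L2t.
have IE : \int[mu]_x (dphi (m t x) * (m s x - m t x)) =
    (s - t) * (\int[mu]_x (dphi (m t x) * mt x) + \int[mu]_x (dphi (m t x) * r s x)).
  rewrite -RintegralD//; try exact: L2_integrableM.
  rewrite -RintegralZl//.
    by apply: eq_Rintegral => x _; rewrite mE; ring.
  by apply: integrableD_EFin => //; exact: L2_integrableM.
have qE : sqint (fun x => m s x - m t x) <= (s - t) ^+ 2 * (2 * (sqint mt + q s)).
  rewrite (_ : sqint _ = (s - t) ^+ 2 * sqint (fun x => mt x + r s x)).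
    by rewrite ler_wpM2l ?sqr_ge0//; exact: sqintD_le.
  rewrite /sqint -RintegralZl//; last by case: (L2D L2mt L2r).
  by apply: eq_Rintegral => x _; rewrite mE exprMn.
have := energy_taylor L2t L2s; rewrite IE => /le_trans/(_ qE).
set A := energy phi (m s) - _; set I := \int[mu]_x (dphi _ * mt x).
set J := \int[mu]_x (dphi _ * _) => h.
have JK : `|J| <= K * Num.sqrt (q s) by exact: dphi_pairing_le.
have -> : A / (s - t) - I = J + (A - (s - t) * (I + J)) / (s - t) by field.
apply: le_trans (ler_normD _ _) _; apply: lerD => //.
rewrite normrM normfV ler_pdivrMr ?normr_gt0//; apply: le_trans h _.
by rewrite -[(s - t) ^+ 2]real_normK ?num_real// expr2 [leRHS]mulrAC.
Unshelve. all: by end_near. Qed.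

End energy_in_time.

(** * Gronwall's inequality in both directions *)

Section gronwall.
Set Implicit Arguments.
Unset Strict Implicit.
Context {R : realType}.
Implicit Types (F dF : R -> R) (a b c C : R).

(** exp(-C y) F is nonincreasing and exp(C y) F is nondecreasing. As F is nonnegative, the first
    carries a zero from [a] to [b] and the second from [b] to [a]. *)
Lemma gronwall_zero F dF a b C : a <= b -> {within `[a, b], continuous F} ->
  (forall x, x \in `]a, b[ -> is_derive x (1 : R) F (dF x)) ->
  (forall x, x \in `]a, b[ -> `|dF x| <= C * F x) ->
  (forall x, 0 <= F x) -> F a = 0 <-> F b = 0.
Proof.
move=> ab cF dFE FC F0.
have dE c x : x \in `]a, b[ ->
    is_derive x (1 : R) (fun y => expR (c * y) * F y) (expR (c * x) * (c * F x + dF x)).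
  move=> xab; have h := @is_derive1_comp R expR (fun y => c * y + 0) x _ _
    (is_derive_expR _) (is_derive_affine c 0 x).
  have := is_deriveM h (dFE x xab) => hM.
  rewrite (_ : (fun y => _) = (expR \o (fun y => c * y + 0)) * F); last first.
    by apply: funext => y; rewrite mulrfctE /= addr0.
  apply: is_derive_eq hM _.
  by rewrite /GRing.scale/= addr0; ring.
have cE c : {within `[a, b], continuous (fun y => expR (c * y) * F y)}.
  move=> x; apply: (@continuousM R (subspace `[a, b]) (fun y => expR (c * y)) F x); last exact: cF.
  apply: continuous_subspaceT => {}x.
  apply: (@continuous_comp _ _ _ (fun y => c * y) expR); last exact: continuous_expR.
  by apply: cvgM; [exact: cvg_cst|exact: cvg_id].
have dc c x : x \in `]a, b[ -> derivable (fun y => expR (c * y) * F y) x 1.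
  by move=> xab; have := dE c x xab => H; exact: ex_derive.
have d1 c x : x \in `]a, b[ -> derive1 (fun y => expR (c * y) * F y) x =
    expR (c * x) * (c * F x + dF x).
  by move=> xab; rewrite derive1E; have := dE c x xab => H; rewrite derive_val.
split=> F0'.
- have := ler0_derive1_nincr (dc (- C)) _ (cE (- C)) (lexx a) ab (lexx b).
  rewrite F0' mulr0 => h; apply/eqP; rewrite eq_le F0 andbT.
  rewrite -(pmulr_rle0 _ (expR_gt0 (- C * b))); apply: h => x xab.
  rewrite d1// pmulr_rle0 ?expR_gt0//.
  by have := FC x xab; rewrite ler_norml => /andP[_]; lra.
- have := ger0_derive1_ndecr (dc C) _ (cE C) (lexx a) ab (lexx b).
  rewrite F0' mulr0 => h; apply/eqP; rewrite eq_le F0 andbT.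
  rewrite -(pmulr_rle0 _ (expR_gt0 (C * a))); apply: h => x xab.
  rewrite d1// mulr_ge0 ?expR_ge0//.
  by have := FC x xab; rewrite ler_norml => /andP[+ _]; lra.
Qed.

End gronwall.

(** * Sobolev spaces *)

Section sobolev_spaces.
Set Implicit Arguments.
Unset Strict Implicit.
Context {R : realType}.
Local Notation mu := (@lebesgue_measure R).
Implicit Types (f g h : R -> R) (j k : nat).

Lemma test_function_derive1n j phi : @test_function R phi -> test_function (derive1n j phi).
Proof.
move=> tphi; elim: j => [//|j IH]; rewrite derive1nS; exact: test_function_derive1.
Qed.

Lemma weak_derivativeZ j f g c : weak_derivative j f g ->
  weak_derivative j (fun x => c * f x) (fun x => c * g x).
Proof.
move=> [lf lg fg]; split; [exact: locally_integrableZ|exact: locally_integrableZ|].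
move=> phi tphi; under eq_Rintegral do rewrite -mulrA.
rewrite RintegralZl//; last first.
  by apply: integrable_mul_test_function => //; exact: test_function_derive1n.
rewrite fg//; under [in RHS]eq_Rintegral do rewrite -mulrA.
by rewrite RintegralZl//; [rewrite mulrCA|exact: integrable_mul_test_function].
Qed.

Lemma weak_derivativeB j f1 g1 f2 g2 :
  weak_derivative j f1 g1 -> weak_derivative j f2 g2 ->
  weak_derivative j (fun x => f1 x - f2 x) (fun x => g1 x - g2 x).
Proof.
move=> [lf1 lg1 fg1] [lf2 lg2 fg2].
split; [exact: locally_integrableB|exact: locally_integrableB|].
move=> phi tphi; under eq_Rintegral do rewrite mulrBl.
have tphij := test_function_derive1n j tphi.
rewrite RintegralB//; try exact: integrable_mul_test_function.
rewrite fg1// fg2// -mulrBr; congr (_ * _).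
under [in RHS]eq_Rintegral do rewrite mulrBl.
by rewrite RintegralB//; exact: integrable_mul_test_function.
Qed.

Lemma wderivP j f g : weak_derivative j f g -> weak_derivative j f (wderiv j f).
Proof. by move=> fg; apply: (@xgetPex _ (cst 0) [set g | weak_derivative j f g]); exists g. Qed.

Lemma wderiv_ae j f g : weak_derivative j f g ->
  {ae mu, forall x, wderiv j f x = g x}.
Proof. by move=> fg; exact: weak_derivative_unique (wderivP fg) fg. Qed.

Lemma weak_derivative_measurable j f g : weak_derivative j f g ->
  measurable_fun setT g.
Proof. by case=> _ []. Qed.

Lemma poweR_Lnorm2 f : L2 f -> ('N[mu]_(2%:E)[EFin \o f] `^ 2 = (sqint f)%:E)%E.
Proof.
move=> [mf f2].
rewrite powR_Lnorm// /sqint /Rintegral fineK; last by apply: integrable_fin_num f2.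
apply: eq_integral => x _ /=.
by rewrite powR_mulrn// real_normK ?num_real.
Qed.

Lemma L2_in_Lfun f : L2 f -> f \in Lfun mu 2%:E.
Proof.
move=> L2f; have N2 := poweR_Lnorm2 L2f.
rewrite inE; apply/andP; split; rewrite inE/=; first by case: L2f.
rewrite /finite_norm ltey; apply/eqP => Ny; move: N2.
by rewrite Ny poweRyr.
Qed.

Lemma Lnorm2_sqint f : L2 f -> ('N[mu]_(2%:E)[EFin \o f] ^+ 2 = (sqint f)%:E)%E.
Proof.
move=> /poweR_Lnorm2; set N := ('N[_]__[_])%E => N2.
have : (0 <= N)%E by exact: Lnorm_ge0.
case: N N2 => [r| |]//.
  by rewrite poweR_EFin => -[<-]; rewrite lee_fin => r0; rewrite powR_mulrn.
by rewrite poweRyr.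
Qed.

Lemma sobolev_wderiv k f j : sobolev k f -> (j <= k)%N ->
  weak_derivative j f (wderiv j f) /\ L2 (wderiv j f).
Proof.
move=> /(_ j) kf /kf[g fg /L2_Lfun L2g]; split; first exact: wderivP fg.
apply: L2_ae L2g (weak_derivative_measurable (wderivP fg)) _.
exact: weak_derivative_unique fg (wderivP fg).
Qed.

Lemma sobolev_locally_integrable k f : sobolev k f -> locally_integrable setT f.
Proof. by move=> /sobolev_wderiv/(_ (leq0n k))[[]]. Qed.

Lemma wderiv0_ae k f : sobolev k f -> {ae mu, forall x, wderiv 0 f x = f x}.
Proof.
move=> /sobolev_locally_integrable lf; apply: wderiv_ae; split => // phi _.
by rewrite expr0 mul1r.
Qed.

Lemma sobolev_leq k l f : (k <= l)%N -> sobolev l f -> sobolev k f.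
Proof. by by move=> kl lf j jk; exact: (lf j (leq_trans jk kl)). Qed.

Lemma sobolevZ k f c : sobolev k f -> sobolev k (fun x => c * f x).
Proof.
move=> kf j jk; have [g fg L2g] := kf j jk.
exists (fun x => c * g x); first exact: weak_derivativeZ.
by apply/L2_in_Lfun/L2Z/L2_Lfun.
Qed.

Lemma sobolevB k f g : sobolev k f -> sobolev k g -> sobolev k (fun x => f x - g x).
Proof.
move=> kf kg j jk; have [f' ff' L2f] := kf j jk; have [g' gg' L2g] := kg j jk.
exists (fun x => f' x - g' x); first exact: weak_derivativeB.
by apply/L2_in_Lfun/L2B; exact: L2_Lfun.
Qed.

Lemma wderivB_ae k f g j : sobolev k f -> sobolev k g -> (j <= k)%N ->
  {ae mu, forall x, wderiv j (fun x => f x - g x) x = wderiv j f x - wderiv j g x}.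
Proof.
move=> kf kg jk; apply: wderiv_ae; apply: weak_derivativeB.
  by case: (sobolev_wderiv kf jk).
by case: (sobolev_wderiv kg jk).
Qed.

Lemma wderivZ_ae k f c j : sobolev k f -> (j <= k)%N ->
  {ae mu, forall x, wderiv j (fun x => c * f x) x = c * wderiv j f x}.
Proof.
move=> kf jk; apply: wderiv_ae; apply: weak_derivativeZ.
by case: (sobolev_wderiv kf jk).
Qed.

Lemma sobolev_norm_sqrt k f : sobolev k f ->
  sobolev_norm k f = (Num.sqrt (\sum_(j < k.+1) sqint (wderiv j f)))%:E.
Proof.
move=> kf; rewrite /sobolev_norm.
rewrite (eq_bigr (fun j : 'I_k.+1 => (sqint (wderiv j f))%:E)); last first.
  by move=> j _; rewrite Lnorm2_sqint//; case: (sobolev_wderiv kf (ltn_ord j)).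
rewrite sumEFin poweR_EFin powR12_sqrt//.
by apply: sumr_ge0 => j _; exact: sqint_ge0.
Qed.

(** The squared norm is a sum of nonnegative terms, so each term is bounded by it. *)
Lemma sobolev_norm_cvg0 (G : set_system R) (FG : Filter G) k (f : R -> R -> R) j :
  (\forall s \near G, sobolev k (f s)) ->
  sobolev_norm k (f s) @[s --> G] --> 0%E -> (j <= k)%N ->
  sqint (wderiv j (f s)) @[s --> G] --> (0 : R).
Proof.
move=> kf f0 jk; move/fine_cvgP : f0 => [_ f0].
apply/cvgr0Pnorm_le => e e0.
have se0 : 0 < Num.sqrt e by rewrite sqrtr_gt0.
move/cvgr0Pnorm_le : f0 => /(_ _ se0) f0.
near=> s; have ks : sobolev k (f s) by near: s.
have S0 : 0 <= \sum_(i < k.+1) sqint (wderiv i (f s)).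
  by apply: sumr_ge0 => i _; exact: sqint_ge0.
have : `|fine (sobolev_norm k (f s))| <= Num.sqrt e by near: s.
rewrite sobolev_norm_sqrt//= ger0_norm ?sqrtr_ge0// ler_sqrt ?(ltW e0)// => h.
rewrite ger0_norm ?sqint_ge0//; apply: le_trans h.
rewrite (bigD1 (Ordinal (jk : (j < k.+1)%N)))//= lerDl.
by apply: sumr_ge0 => i _; exact: sqint_ge0.
Unshelve. all: by end_near. Qed.

(** Bootstrapping: each of the weak derivatives of order 1 and 2 is almost everywhere a primitive of
    the next, hence has a continuous representative, which makes the preceding function classically
    differentiable. The chain stops at order 3, whose weak derivative need not be continuous. *)
Lemma sobolev3_regular f : sobolev 3 f -> continuous f ->
  [/\ primitive f (derive1 f), primitive (derive1 f) (derive1n 2 f),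
      primitive (derive1n 2 f) (wderiv 3 f),
      {ae mu, forall x, wderiv 1 f x = derive1 f x} &
      {ae mu, forall x, wderiv 2 f x = derive1n 2 f x}].
Proof.
move=> f3 cf.
have [w1 _] := sobolev_wderiv f3 (isT : (1 <= 3)%N).
have [w2 _] := sobolev_wderiv f3 (isT : (2 <= 3)%N).
have [w3 _] := sobolev_wderiv f3 (isT : (3 <= 3)%N).
have p1 := weak_derivative_continuous_primitive cf w1.
have [F1 F1w2 w1F1] := weak_derivative_primitive (weak_derivativeS w1 w2).
have [F2 F2w3 w2F2] := weak_derivative_primitive (weak_derivativeS w2 w3).
have cF1 := primitive_continuous F1w2; have cF2 := primitive_continuous F2w3.
have {}p1 := primitive_ae p1 (continuous_locally_integrable cF1) w1F1.
have p2 := primitive_ae F1w2 (continuous_locally_integrable cF2) w2F2.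
have e1 : derive1 f = F1 by apply: is_derive_derive1; exact: primitive_is_derive.
have e2 : derive1n 2 f = F2.
  by rewrite derive1Sn derive1n1 e1; apply: is_derive_derive1; exact: primitive_is_derive.
by rewrite e1 e2.
Qed.



End sobolev_spaces.

(** * The equation V'' = V *)

Section elliptic.
Set Implicit Arguments.
Unset Strict Implicit.
Context {R : realType}.
Local Notation mu := (@lebesgue_measure R).
Implicit Types (f g p dp U V W : R -> R) (c K : R).

Lemma nincr_decay_zero p dp c K :
  (forall x : R, is_derive x (1 : R) p (dp x)) -> (forall x, dp x <= 0) ->
  p c = 0 -> (forall x, `|p x| <= K * expR (- x)) ->
  forall x, c <= x -> p x = 0.
Proof.
move=> pdp dp0 pc pK.
have dE x : derivable p x 1 by have := pdp x => H; exact: ex_derive.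
have cp : continuous p by move=> x; apply/differentiable_continuous/derivable1_diffP.
have mono x y : x <= y -> p y <= p x.
  move=> xy; apply: (@ler0_derive1_nincr R p x y) => //.
  - by move=> z _; rewrite (is_derive_derive1 pdp).
  - exact: continuous_subspaceT.
move=> x cx; apply/eqP; rewrite eq_le -{1}pc mono//=.
rewrite leNgt; apply/negP => px.
have K0 : 0 < K.
  have := le_trans (normr_ge0 _) (pK x); rewrite pmulr_lge0 ?expR_gt0//.
  rewrite le_eqVlt => /predU1P[K0|//].
  by have := pK x; rewrite -K0 mul0r normr_le0 => /eqP h; rewrite h ltxx in px.
have npx : 0 < - p x / K by rewrite divr_gt0// oppr_gt0.
(* Far enough to the right that K exp(-y) <= -p(x)/e < -p(x), while monotonicity keeps p(y) <= p(x):
   this contradicts the decay bound. *)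
pose y := Num.max x (1 - ln (- p x / K)).
have xy : x <= y by rewrite le_max lexx.
have yl : 1 - ln (- p x / K) <= y by rewrite le_max lexx orbT.
have := pK y; rewrite ler_norml => /andP[+ _].
apply/negP; rewrite -ltNge; apply: le_lt_trans (mono _ _ xy) _.
rewrite ltrNr -ltr_pdivlMl// mulrC.
apply: (@le_lt_trans _ _ (expR (ln (- p x / K) - 1))).
  by rewrite ler_expR; lra.
by rewrite -[ltRHS]lnK ?posrE// ltr_expR; lra.
Qed.

Lemma is_derive_expRN (x : R) : is_derive x (1 : R) (fun y => expR (- y)) (- expR (- x)).
Proof.
have := @is_derive1_comp R expR (fun y => (-1) * y + 0) x _ _
  (is_derive_expR _) (is_derive_affine (-1) 0 x).
rewrite (_ : expR \o _ = (fun y => expR (- y))); last first.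
  by apply: funext => y /=; rewrite addr0 mulN1r.
by rewrite addr0 mulN1r mulrN1.
Qed.

Lemma helmholtz_zero_right V dV ddV c K :
  (forall x : R, is_derive x (1 : R) V (dV x)) ->
  (forall x : R, is_derive x (1 : R) dV (ddV x)) ->
  (forall x, `|V x| <= K) -> (forall x, `|dV x| <= K) ->
  (forall x, ddV x <= V x) -> V c = 0 -> dV c = 0 ->
  forall x, c < x -> ddV x = V x.
Proof.
move=> VdV dVddV VK dVK sg Vc dVc x cx.
pose p y := expR (- y) * (V y + dV y).
have dp y : is_derive y (1 : R) p (expR (- y) * (ddV y - V y)).
  have := is_deriveM (is_derive_expRN y) (is_deriveD (VdV y) (dVddV y)) => h.
  apply: is_derive_eq h _.
  by rewrite /GRing.scale /= addrfctE; ring.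
have pz := @nincr_decay_zero p _ c (2 * K) dp.
have {}pz y : c <= y -> p y = 0.
  apply: pz => [z||z].
  - by rewrite pmulr_rle0 ?expR_gt0// subr_le0.
  - by rewrite /p Vc dVc addr0 mulr0.
  - rewrite normrM mulrC [`|expR _|]ger0_norm ?expR_ge0// ler_wpM2r ?expR_ge0//.
    by apply: le_trans (ler_normD _ _) _; have := VK z; have := dVK z; lra.
(* As c < x is strict, [p] vanishes on a whole neighbourhood of [x]; comparing the two values of its
   derivative there gives V'' = V. *)
have : is_derive x (1 : R) p 0.
  apply: (@near_eq_is_derive R R R (cst 0)).
  near=> y; rewrite pz//; apply: ltW; near: y; exact: lt_nbhsr.
move=> h0; have := dp x => h1.
have : 'D_1 p x = 0 by case: h0.
have -> : 'D_1 p x = expR (- x) * (ddV x - V x) by case: h1.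
move=> /eqP; rewrite mulf_eq0 gt_eqF ?expR_gt0//= subr_eq0 => /eqP.
exact.
Unshelve. all: by end_near. Qed.

Lemma helmholtz_zero V dV ddV (a b : R) K : a < b ->
  (forall x : R, is_derive x (1 : R) V (dV x)) ->
  (forall x : R, is_derive x (1 : R) dV (ddV x)) ->
  (forall x, `|V x| <= K) -> (forall x, `|dV x| <= K) ->
  (forall x, ddV x <= V x) -> (forall x, x \in `]a, b[ -> V x = 0) ->
  forall x, ddV x = V x.
Proof.
move=> ab VdV dVddV VK dVK sg V0.
have dV0 c : c \in `]a, b[ -> dV c = 0.
  rewrite in_itv/= => /andP[ac cb].
  have : is_derive c (1 : R) V 0.
    apply: (@near_eq_is_derive R R R (cst 0)).
    near=> y; rewrite V0// in_itv/=; apply/andP; split; near: y.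
      exact: lt_nbhsr.
    exact: lt_nbhsl.
  have := VdV c => -[_ <-] [_ <-]; by [].
have right c x : c \in `]a, b[ -> c < x -> ddV x = V x.
  move=> cab; apply: (helmholtz_zero_right VdV dVddV VK dVK sg); first exact: V0.
  exact: dV0.
have left c x : c \in `]a, b[ -> x < c -> ddV x = V x.
  move=> cab xc.
  (* The left half follows from the right half by the reflection x -> -x, which preserves V'' <=
     V. *)
  have N (f df : R -> R) : (forall x : R, is_derive x (1 : R) f (df x)) ->
      forall x : R, is_derive x (1 : R) (fun y => f (- y)) (- df (- x)).
    move=> fdf y; have := @is_derive1_comp R f (fun y => (-1) * y + 0) y _ _
      (fdf _) (is_derive_affine (-1) 0 y).
    rewrite (_ : f \o _ = (fun y => f (- y))); last first.
      by apply: funext => z /=; rewrite addr0 mulN1r.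
    by rewrite addr0 mulN1r mulrN1.
  have dd : forall y : R, is_derive y (1 : R) (fun z => - dV (- z)) (ddV (- y)).
    by move=> y; have := is_deriveN (N _ _ dVddV y); rewrite opprK.
  have := @helmholtz_zero_right (fun y => V (- y)) _ _ (- c) K (N _ _ VdV) dd.
  have -> : x = - - x by rewrite opprK.
  apply => //; rewrite ?opprK ?V0 ?dV0 ?oppr0 ?ltrN2//.
  by move=> y; rewrite normrN.
move=> x; have mid c : a < c -> c < b -> c \in `]a, b[.
  by move=> ac cb; rewrite in_itv/= ac cb.
(* Two points of the interval are used because each half is strict: (a + 3b)/4 lies to the right of
   the midpoint and so covers it. *)
have [ax|xa] := ltP ((a + b) / 2) x.
  by apply: (right ((a + b) / 2)) => //; apply: mid; lra.
by apply: (left ((a + 3 * b) / 4)); [apply: mid; lra|lra].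
Unshelve. all: by end_near. Qed.

(** (V V')' = V'^2 + V^2 has zero integral, so V and V' vanish in L^2, and the pointwise bound on V
    concludes. Square integrability is what rules out the solutions exp(x) and exp(-x). *)
Lemma primitive_helmholtz_zero V dV ddV : primitive V dV -> primitive dV ddV ->
  L2 V -> L2 dV -> (forall x, ddV x = V x) -> forall x, V x = 0.
Proof.
move=> p1 p2 L2V L2dV eq x.
have eqf : ddV = V by apply: funext.
rewrite eqf in p2.
have I1 := L2_integrableM L2dV L2dV.
have I2 := L2_integrableM L2V L2V.
have := Rintegral_primitive0 (primitiveM p1 p2) (L2_integrableM L2V L2dV)
  (integrableD_EFin measurableT I1 I2).
rewrite RintegralD// => h.
have : sqint dV + sqint V = 0 by [].
move=> h2; apply/eqP; rewrite -sqrf_eq0 eq_le sqr_ge0 andbT.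
by have := primitive_sup_bound x p1 L2V L2dV; rewrite addrC h2 mulr0.
Qed.

End elliptic.

(** * Evolution of the momentum *)

Section evolution.
Set Implicit Arguments.
Unset Strict Implicit.
Context {R : realType}.
Local Notation mu := (@lebesgue_measure R).
Implicit Types (f g : R -> R) (a b s t : R).

Lemma is_derive_quotient f t l :
  (f s - f t) / (s - t) @[s --> t^'] --> l -> is_derive t (1 : R) f l.
Proof.
move=> fl.
have h0 : (fun h => h^-1 *: (f (h *: 1 + t) - f t)) @ (0 : R)^' --> l.
  have sh : (fun h : R => h + t) @ (0 : R)^' --> t^'.
    move=> P /nbhs_ballP[d /= d0 dP]; apply/nbhs_ballP; exists d => // h /= hd h0.
    apply: dP; last by rewrite -subr_eq0 addrK.
    by move: hd; rewrite /ball/= sub0r normrN opprD addrCA subrr addr0 normrN.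
  have := cvg_comp _ _ sh fl; apply: cvg_trans; apply: near_eq_cvg; near=> h.
  by rewrite /GRing.scale/= mulr1 addrK mulrC.
split; last by apply/cvg_lim.
by apply/cvg_ex; exists l.
Unshelve. all: by end_near. Qed.

Lemma primitive_bounded f g : primitive f g -> L2 f -> L2 g ->
  forall x, `|f x| <= Num.sqrt (2 * (sqint f + sqint g)).
Proof.
move=> fg L2f L2g x; rewrite -sqrtr_sqr ler_sqrt ?mulr_ge0 ?addr_ge0 ?sqint_ge0//.
exact: primitive_sup_bound.
Qed.

Lemma L2_derive1n f j : sobolev 3 f -> continuous f -> (j <= 2)%N ->
  L2 (derive1n j f) /\ {ae mu, forall x, wderiv j f x = derive1n j f x}.
Proof.
move=> f3 cf j2; have [p1 p2 p3 w1 w2] := sobolev3_regular f3 cf.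
have wd : {ae mu, forall x, wderiv j f x = derive1n j f x}.
  case: j j2 => [|[|[|j]]] j2; last first.
  - by exfalso; move: j2; clear.
  - exact: w2.
  - rewrite derive1n1. exact: w1.
  - rewrite derive1n0. exact: wderiv0_ae f3.
have [_ L2w] := sobolev_wderiv f3 (leq_trans j2 (isT : (2 <= 3)%N)).
split => //; apply: L2_ae L2w _ wd; apply: continuous_measurable_fun.
case: j j2 => [|[|[|j]]] j2; last by exfalso; move: j2; clear.
- by rewrite derive1n0.
- by rewrite derive1n1; exact: primitive_continuous p2.
- exact: primitive_continuous p3.
Qed.

Variables (T : \bar R) (u0 : R -> R) (u : R -> R -> R).
Hypothesis u_sol : solution T u0 u.

Local Notation m t := (momentum (u t)).

Let u3 t : lifetime T t -> sobolev 3 (u t).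
Proof. by move=> lt; case: u_sol => -[+ _] _ _ _; exact. Qed.

Let cu t : lifetime T t -> continuous (u t).
Proof. by move=> lt; case: u_sol => _ + _ _; exact. Qed.

Lemma L2_momentum t : lifetime T t -> L2 (m t).
Proof.
move=> lt; apply: L2B.
  by case: (L2_derive1n (u3 lt) (cu lt) (isT : (0 <= 2)%N)).
by case: (L2_derive1n (u3 lt) (cu lt) (isT : (2 <= 2)%N)).
Qed.

Let sqint_wderiv_cvg t j : lifetime T t -> (j <= 2)%N ->
  sqint (wderiv j (fun x => u s x - u t x)) @[s --> within (lifetime T) (nbhs t)] --> (0 : R).
Proof.
move=> lt j2; case: u_sol => -[_ C0u] _ _ _.
apply: (sobolev_norm_cvg0 _ _ (C0u t lt)); last exact: leq_trans j2 _.
near=> s; apply: sobolevB; apply: u3 => //.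
by near: s; exact: withinT.
Unshelve. all: by end_near. Qed.

Let wderivB_derive1n s t j : lifetime T s -> lifetime T t -> (j <= 2)%N ->
  {ae mu, forall x, wderiv j (fun x => u s x - u t x) x =
    derive1n j (u s) x - derive1n j (u t) x}.
Proof.
move=> ls lt j2.
have [_ ws] := L2_derive1n (u3 ls) (cu ls) j2.
have [_ wt] := L2_derive1n (u3 lt) (cu lt) j2.
have w := wderivB_ae (u3 ls) (u3 lt) (leq_trans j2 (isT : (2 <= 3)%N)).
apply: ae_mono2 w (ae_mono2 _ ws wt) => [x -> E|x es et]; last first.
  exact: (conj es et).
by case: E => -> ->.
Qed.

Let sqint_derive1n_cvg t j : lifetime T t -> (j <= 2)%N ->
  sqint (fun x => derive1n j (u s) x - derive1n j (u t) x)
    @[s --> within (lifetime T) (nbhs t)] --> (0 : R).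
Proof.
move=> lt j2; apply: cvg_trans (sqint_wderiv_cvg lt j2); apply: near_eq_cvg.
near=> s; have ls : lifetime T s by near: s; exact: withinT.
apply: sqint_ae; last exact: wderivB_derive1n.
- by case: (sobolev_wderiv (sobolevB (u3 ls) (u3 lt)) (leq_trans j2 (isT : (2 <= 3)%N))).
- apply: L2B; first by case: (L2_derive1n (u3 ls) (cu ls) j2).
  by case: (L2_derive1n (u3 lt) (cu lt) j2).
Unshelve. all: by end_near. Qed.

(** With phi = x^2 the energy is the squared L^2 norm, so this yields the continuity in time of the
    norms that enter Gronwall's constant. *)
Let energy_derive1n_cvg phi dphi t j : C11 phi dphi -> phi 0 = 0 -> dphi 0 = 0 ->
  lifetime T t -> (j <= 2)%N ->
  energy phi (derive1n j (u s)) @[s --> within (lifetime T) (nbhs t)] -->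
  energy phi (derive1n j (u t)).
Proof.
move=> C11phi phi0 dphi0 lt j2; apply: (energy_cvg C11phi phi0 dphi0).
- by case: (L2_derive1n (u3 lt) (cu lt) j2).
- near=> s; have ls : lifetime T s by near: s; exact: withinT.
  by case: (L2_derive1n (u3 ls) (cu ls) j2).
- exact: sqint_derive1n_cvg.
Unshelve. all: by end_near. Qed.

Let energy_momentum_cvg phi dphi t : C11 phi dphi -> phi 0 = 0 -> dphi 0 = 0 ->
  lifetime T t ->
  energy phi (m s) @[s --> within (lifetime T) (nbhs t)] --> energy phi (m t).
Proof.
move=> C11phi phi0 dphi0 lt; apply: (energy_cvg C11phi phi0 dphi0).
- exact: L2_momentum.
- by near=> s; apply: L2_momentum; near: s; exact: withinT.
- pose q j s := sqint (fun x => derive1n j (u s) x - derive1n j (u t) x).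
  apply: (@squeeze_cvgr _ _ _ _ (cst 0) (fun s => 2 * (q 0%N s + q 2%N s))).
  + near=> s; have ls : lifetime T s by near: s; exact: withinT.
    rewrite sqint_ge0/=.
    have L2d j : (j <= 2)%N -> L2 (fun x => derive1n j (u s) x - derive1n j (u t) x).
      move=> j2; apply: L2B; first by case: (L2_derive1n (u3 ls) (cu ls) j2).
      by case: (L2_derive1n (u3 lt) (cu lt) j2).
    have := sqintB_le (L2d 0%N isT) (L2d 2%N isT); apply: le_trans.
    rewrite le_eqVlt; apply/orP; left; apply/eqP; apply: eq_Rintegral => x _.
    have subACA (a b c d : R) : a - b - (c - d) = a - c - (b - d) by ring.
    by rewrite /momentum !derive1n0 subACA.
  + exact: cvg_cst.
  + have : 2 * (q 0%N s + q 2%N s) @[s --> within (lifetime T) (nbhs t)] --> 2 * (0 + 0 : R).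
      by apply: cvgM; [exact: cvg_cst|apply: cvgD; exact: sqint_derive1n_cvg].
    by rewrite addr0 mulr0.
Unshelve. all: by end_near. Qed.

Let lifetime_itv a b : lifetime T a -> lifetime T b -> `[a, b] `<=` lifetime T.
Proof.
move=> [a0 _] [_ bT] x /=; rewrite in_itv/= => /andP[ax xb].
by split; [exact: (le_trans a0 ax)|apply: (le_lt_trans _ bT); rewrite lee_fin].
Qed.

Let continuous_within_lifetime (F : R -> R) a b :
  (forall t, lifetime T t -> F s @[s --> within (lifetime T) (nbhs t)] --> F t) ->
  lifetime T a -> lifetime T b -> {within `[a, b], continuous F}.
Proof.
move=> FT la lb; apply/subspace_continuousP => x abx.
have lx := lifetime_itv la lb abx.
apply: cvg_trans (FT x lx); apply: cvg_app; apply: within_subset.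
exact: lifetime_itv.
Qed.

(** This is - u m_x, the value that the equation prescribes for m_t; the derivative of u_xx in m_x
    is the weak one. *)
Let mt t x := - (u t x * (derive1 (u t) x - wderiv 3 (u t) x)).

Let primitive_momentum t : lifetime T t ->
  primitive (m t) (fun x => derive1 (u t) x - wderiv 3 (u t) x).
Proof.
move=> lt; have [p1 p2 p3 _ _] := sobolev3_regular (u3 lt) (cu lt).
exact: primitiveB p1 p3.
Qed.

Let L2_derive1_momentum t : lifetime T t ->
  L2 (fun x => derive1 (u t) x - wderiv 3 (u t) x).
Proof.
move=> lt; apply: L2B.
  by have [+ _] := L2_derive1n (u3 lt) (cu lt) (isT : (1 <= 2)%N); rewrite derive1n1.
by have [_ +] := sobolev_wderiv (u3 lt) (isT : (3 <= 3)%N).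
Qed.

Let u_bounded t : lifetime T t -> exists K, forall x, `|u t x| <= K.
Proof.
move=> lt; have [p1 _ _ _ _] := sobolev3_regular (u3 lt) (cu lt).
have [L0 _] := L2_derive1n (u3 lt) (cu lt) (isT : (0 <= 2)%N).
have [L1 _] := L2_derive1n (u3 lt) (cu lt) (isT : (1 <= 2)%N).
rewrite derive1n0 in L0; rewrite derive1n1 in L1.
exists (Num.sqrt (2 * (sqint (u t) + sqint (derive1 (u t))))).
exact: primitive_bounded.
Qed.

Let ux_bounded t : lifetime T t -> forall x, `|derive1 (u t) x| <=
  Num.sqrt (2 * (sqint (derive1n 1 (u t)) + sqint (derive1n 2 (u t)))).
Proof.
move=> lt; have [_ p2 _ _ _] := sobolev3_regular (u3 lt) (cu lt).
have [L1 _] := L2_derive1n (u3 lt) (cu lt) (isT : (1 <= 2)%N).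
have [L2' _] := L2_derive1n (u3 lt) (cu lt) (isT : (2 <= 2)%N).
rewrite derive1n1 in L1 *; exact: primitive_bounded.
Qed.

Let L2_mt t : lifetime T t -> L2 (mt t).
Proof.
move=> lt; have [K uK] := u_bounded lt.
have [md d2] := L2_derive1_momentum lt.
have mut := continuous_measurable_fun (cu lt).
split; first by apply: measurableT_comp => //; exact: measurable_funM.
rewrite /mt; under eq_fun do rewrite sqrrN exprMn mulrC.
apply: (@integrable_bounded_mul _ _ _ _ (K ^+ 2)) => //; first exact: measurable_funX.
move=> x _; rewrite normrX lerXn2r ?nnegrE//.
exact: le_trans (uK x).
Qed.

(** The difference quotient of u converges to u_t in H^2; subtracting its second derivative gives
    convergence of the quotient of m in L^2. The equation then identifies the limit u_t - u_txx with
    [mt]. *)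
Let momentum_quotient_cvg t : lifetime T t ->
  sqint (fun x => (m s x - m t x) / (s - t) - mt t x)
    @[s --> within (lifetime T) t^'] --> (0 : R).
Proof.
move=> lt; case: (u_sol) => _ _ _ [ut [_ [ut2 _] Cq] pde].
have FF : Filter (within (lifetime T) t^') by exact: within_filter.
have ut2t := ut2 t lt.
pose D s x := (u s x - u t x) / (s - t) - ut t x.
have DE s : D s = (fun x => (s - t)^-1 * (u s x - u t x) - ut t x).
  by apply: funext => x; rewrite /D mulrC.
have u2 s : lifetime T s -> sobolev 2 (u s).
  by move=> ls; exact: sobolev_leq (isT : (2 <= 3)%N) (u3 ls).
have D2 s : lifetime T s -> sobolev 2 (D s).
  by move=> ls; rewrite DE; apply: sobolevB => //; apply: sobolevZ; apply: sobolevB; exact: u2.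
have Dj j : (j <= 2)%N -> sqint (wderiv j (D s)) @[s --> within (lifetime T) t^'] --> (0 : R).
  move=> j2; apply: (sobolev_norm_cvg0 FF _ (Cq t lt)) => //.
  by near=> s; apply: D2; near: s; exact: withinT.
have wD s j : lifetime T s -> (j <= 2)%N ->
    {ae mu, forall x, wderiv j (D s) x =
      (s - t)^-1 * (derive1n j (u s) x - derive1n j (u t) x) - wderiv j (ut t) x}.
  move=> ls j2; rewrite DE.
  have h1 := wderivB_ae (sobolevZ (s - t)^-1 (sobolevB (u2 s ls) (u2 t lt))) ut2t j2.
  have h2 := wderivZ_ae (s - t)^-1 (sobolevB (u2 s ls) (u2 t lt)) j2.
  have h3 := wderivB_derive1n ls lt j2.
  apply: ae_mono2 h1 (ae_mono2 _ h2 h3) => [x -> E|x e2 e3]; last exact: (conj e2 e3).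
  by case: E => -> ->.
(* The only use of the equation. Weak derivatives of order 0 and 2 appear because [ut t] is known
   only as an element of H^2. *)
have ptE : {ae mu, forall x, wderiv 0 (ut t) x - wderiv 2 (ut t) x = mt t x}.
  have h0 := wderiv0_ae ut2t.
  have [_ _ _ h1 _] := sobolev3_regular (u3 lt) (cu lt).
  apply: ae_mono2 (pde t lt) (ae_mono2 _ h0 h1) => [x P E|x e0 e1]; last exact: (conj e0 e1).
  case: E P => -> -> P; rewrite /mt; apply/eqP; rewrite -subr_eq0 -P; apply/eqP.
  by ring.
apply: (@squeeze_cvgr _ _ _ _ (cst 0)
  (fun s => 2 * (sqint (wderiv 0 (D s)) + sqint (wderiv 2 (D s))))).
- near=> s; have ls : lifetime T s by near: s; exact: withinT.
  rewrite sqint_ge0/=.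
  have [_ L0] := sobolev_wderiv (D2 s ls) (isT : (0 <= 2)%N).
  have [_ L2D] := sobolev_wderiv (D2 s ls) (isT : (2 <= 2)%N).
  have := sqintB_le L0 L2D; apply: le_trans.
  rewrite le_eqVlt; apply/orP; left; apply/eqP; apply: sqint_ae.
  + apply: L2B; last exact: L2_mt.
    have := L2Z (s - t)^-1 (L2B (L2_momentum ls) (L2_momentum lt)).
    by under eq_fun do rewrite mulrC.
  + exact: L2B.
  + have h0 := wD s 0%N ls isT; have h2 := wD s 2%N ls isT.
    apply: ae_mono2 ptE (ae_mono2 _ h0 h2) => [x P E|x e0 e2]; last exact: (conj e0 e2).
    case: E => -> ->; rewrite -P /momentum derive1n0 derive1n0 mulrC.
    move: (u s x) (u t x) (derive1n 2 (u s) x) (derive1n 2 (u t) x) ((s - t)^-1) => a b c d e.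
    by move: (wderiv 0 (ut t) x) (wderiv 2 (ut t) x) => v w; ring.
- exact: cvg_cst.
- have : 2 * (sqint (wderiv 0 (D s)) + sqint (wderiv 2 (D s)))
      @[s --> within (lifetime T) t^'] --> 2 * (0 + 0 : R).
    by apply: cvgM; [exact: cvg_cst|apply: cvgD; exact: Dj].
  by rewrite addr0 mulr0.
Unshelve. all: by end_near. Qed.

Variables (phi dphi : R -> R).
Hypothesis phi_C11 : C11 phi dphi.
Hypothesis phi0 : phi 0 = 0.
Hypothesis dphi0 : dphi 0 = 0.
Hypothesis phi_ge0 : forall x, 0 <= phi x.

Lemma energy_momentum_derive t : 0 < t -> lifetime T t ->
  is_derive t (1 : R) (fun s => energy phi (m s))
    (\int[mu]_x (derive1 (u t) x * phi (m t x))).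
Proof.
move=> t0 lt.
have FF : Filter (within (lifetime T) t^') by exact: within_filter.
have [p1 p2 _ _ _] := sobolev3_regular (u3 lt) (cu lt).
have [Ku uK] := u_bounded lt.
have := energy_transport phi_C11 phi0 dphi0 p1 (primitive_momentum lt)
  (primitive_continuous p2) uK (ux_bounded lt) (L2_momentum lt) (L2_derive1_momentum lt).
move=> /(congr1 -%R); rewrite opprK => <-.
apply: is_derive_quotient.
have -> : - (\int[mu]_x (dphi (m t x) * (u t x * (derive1 (u t) x - wderiv 3 (u t) x)))) =
    \int[mu]_x (dphi (m t x) * mt t x).
  rewrite -[LHS]mulN1r -RintegralZl//.
    by apply: eq_Rintegral => x _; rewrite /mt mulN1r mulrN.
  have := L2_integrableM (L2_dphi phi_C11 dphi0 (L2_momentum lt)) (L2Z (-1) (L2_mt lt)).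
  by congr (integrable _ _ _); apply: funext => x /=; rewrite /mt mulN1r opprK.
have h : (energy phi (m s) - energy phi (m t)) / (s - t)
    @[s --> within (lifetime T) t^'] --> \int[mu]_x (dphi (m t x) * mt t x).
  apply: (energy_quotient_cvg phi_C11 phi0 dphi0).
  - by move=> P Pt; apply: cvg_within; apply: cvg_within.
  - near=> s; near: s; apply: cvg_within; exact: withinT.
  - by near=> s; apply: L2_momentum; near: s; exact: withinT.
  - exact: L2_momentum.
  - exact: L2_mt.
  - exact: momentum_quotient_cvg.
(* For 0 < t < T the lifetime is a neighbourhood of [t], so the limit within it is an ordinary
   limit; t = 0 is excluded for this reason. *)
have nlt : \forall s \near t^', lifetime T s.
  apply: cvg_within; case: lt => _; case: (T) => [r| |]; rewrite ?lte_fin//.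
    move=> tr; near=> s; split; last by rewrite lte_fin; near: s; exact: lt_nbhsl.
    by apply: ltW; near: s; exact: lt_nbhsr.
  move=> _; near=> s; split; last by rewrite ltry.
  by apply: ltW; near: s; exact: lt_nbhsr.
apply: cvg_trans h => P; rewrite /nbhs/= => hP; near=> s; near: s.
by apply: filterS2 nlt hP => s ls; apply.
Unshelve. all: by end_near. Qed.

Lemma energy_momentum_eq0 a b : lifetime T a -> lifetime T b ->
  energy phi (m a) = 0 -> energy phi (m b) = 0.
Proof.
move=> la lb.
suff H x y : lifetime T x -> lifetime T y -> x <= y ->
    energy phi (m x) = 0 <-> energy phi (m y) = 0.
  by case: (leP a b) => [ab|/ltW ba]; [case: (H a b la lb ab)|case: (H b a lb la ba)].
move=> {a b la lb} la lb ab.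
(* The squared H^1 norm of u_x. Pointwise |u_x| <= sqrt(2 B), so the maximum of this continuous
   function on [x, y] yields Gronwall's constant. *)
pose B s := sqint (derive1n 1 (u s)) + sqint (derive1n 2 (u s)).
have cB : {within `[x, y], continuous B}.
  apply: continuous_within_lifetime => // t lt; apply: cvgD.
    exact: (energy_derive1n_cvg C11_sqr (expr0n _ _) (mulr0 _) lt (isT : (1 <= 2)%N)).
  exact: (energy_derive1n_cvg C11_sqr (expr0n _ _) (mulr0 _) lt (isT : (2 <= 2)%N)).
have [c _ Bc] := EVT_max ab cB.
apply: (@gronwall_zero R (fun t => energy phi (m t))
  (fun t => \int[mu]_x (derive1 (u t) x * phi (m t x))) x y (Num.sqrt (2 * B c)) ab).
- by apply: continuous_within_lifetime => // t lt; exact: (energy_momentum_cvg phi_C11 phi0 dphi0 lt).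
- move=> t; rewrite in_itv/= => /andP[xt ty].
  apply: energy_momentum_derive; first by case: la => x0 _; exact: le_lt_trans xt.
  by apply: (lifetime_itv la lb); rewrite /= in_itv/= (ltW xt) (ltW ty).
- move=> t; rewrite in_itv/= => /andP[xt ty].
  have txy : t \in `[x, y] by rewrite in_itv/= (ltW xt) (ltW ty).
  have lt : lifetime T t by exact: (lifetime_itv la lb).
  have I := integrable_phi phi_C11 phi0 dphi0 (L2_momentum lt).
  rewrite /energy -RintegralZl//.
  have [_ p2 _ _ _] := sobolev3_regular (u3 lt) (cu lt).
  have mp : measurable_fun setT (fun x => phi (m t x)).
    by apply/measurable_EFinP; case/integrableP : I.
  apply: ler_norm_Rintegral => //.
  + apply: measurable_funM => //.
    exact: continuous_measurable_fun (primitive_continuous p2).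
  + move=> z _; rewrite normrM (ger0_norm (phi_ge0 _)) ler_wpM2r//.
    apply: le_trans (ux_bounded lt z) _; apply: ler_wsqrtr.
    by apply: ler_wpM2l; [exact: ler0n|exact: (Bc t txy)].
  + exact: integrableZ_EFin.
- by move=> t; apply: Rintegral_ge0.
Qed.

End evolution.

(** * Energies that detect the sign of a function *)

Section sign_preservation.
Set Implicit Arguments.
Unset Strict Implicit.
Context {R : realType}.
Local Notation mu := (@lebesgue_measure R).
Implicit Types (f g : R -> R) (a b s t : R).

(** Squaring removes the corner of max(x, 0) at 0, and max(., 0) is 1-Lipschitz. In the Taylor
    bound, when x and y lie on opposite sides of 0, the term -2xy of (y - x)^2 has the favourable
    sign. *)
Lemma C11_pos_part : @C11 R (fun x => Num.max x 0 ^+ 2) (fun x => 2 * Num.max x 0).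
Proof.
split=> x y.
  have hx := sqr_ge0 x; have hy := sqr_ge0 y; have hxy := sqr_ge0 (y - x).
  rewrite ler_norml; apply/andP.
  case: (leP x 0) => x0; case: (leP y 0) => y0.
  - by split; lra.
  - have h : x * y <= 0 by rewrite mulr_le0_ge0// ltW.
    by split; lra.
  - have h : x * y <= 0 by rewrite mulr_ge0_le0// ltW.
    by split; lra.
  - by split; lra.
rewrite -mulrBr normrM ger0_norm// ler_wpM2l//.
by case: (leP x 0) => x0; case: (leP y 0) => y0;
  rewrite ler_norml; apply/andP; split;
  have := ler_norm (y - x); have := ler_norm (x - y); rewrite distrC; lra.
Qed.

Lemma C11_comp_opp (phi dphi : R -> R) : C11 phi dphi ->
  C11 (fun x => phi (- x)) (fun x => - dphi (- x)).
Proof.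
move=> [C1 C2]; split=> x y.
  by have := C1 (- x) (- y); rewrite -opprD mulrN sqrrN mulNr.
by have := C2 (- x) (- y); rewrite -!opprD !normrN.
Qed.

Lemma energy0 (phi : R -> R) f : (forall x, phi (f x) = 0) -> energy phi f = 0.
Proof.
move=> f0; rewrite /energy; under eq_Rintegral do rewrite f0.
by rewrite Rintegral_cst// mul0r.
Qed.

(** A nonnegative function with zero integral vanishes almost everywhere, and continuity upgrades
    this to every point. *)
Lemma energy_eq0 (phi dphi : R -> R) f : C11 phi dphi -> phi 0 = 0 -> dphi 0 = 0 ->
  (forall x, 0 <= phi x) -> continuous f -> L2 f ->
  energy phi f = 0 -> forall x, phi (f x) = 0.
Proof.
move=> phi_C11 phi0 dphi0 phi_ge0 cf L2f E x.
have I := integrable_phi phi_C11 phi0 dphi0 L2f.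
have h : {ae mu, forall x, phi (f x) = cst 0 x}.
  have mI : measurable_fun setT (EFin \o (phi \o f)) by case/integrableP : I.
  have := (ae_eq_integral_abs mu measurableT mI).1.
  have -> : (\int[mu]_x `|(EFin \o (phi \o f)) x|)%E = 0%:E.
    rewrite -E /energy /Rintegral fineK; last by apply: integrable_fin_num I.
    by apply: eq_integral => y _; rewrite /= ger0_norm.
  by move=> /(_ erefl); apply: ae_mono => y /(_ Logic.I) [].
have cphi : continuous (phi \o f).
  have cp : continuous phi := @continuous_phi R phi dphi phi_C11.
  by move=> y; apply: continuous_comp; [exact: cf|exact: cp].
have := ae_eq_continuous cphi (@cst_continuous _ _ _) h.
by move=> /(congr1 (fun g => g x)).
Qed.

End sign_preservation.

Theorem corollary2p1 (R : realType) (T : \bar R) (u0 : R -> R)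
    (u : R -> R -> R)
    (T_gt0 : (0 < T)%E)
    (u0_H3 : sobolev 3 u0)
    (u_sol : solution T u0 u)
    (m0_L1 : momentum u0 \in Lfun (@lebesgue_measure R) 1%E)
    (m0_sign : (forall x, 0 <= momentum u0 x) \/ (forall x, momentum u0 x <= 0))
    (u_rect : exists t0 t1 x0 x1 : R,
      [/\ t0 < t1, x0 < x1,
          `]t0, t1[ `*` `]x0, x1[ `<=` lifetime T `*` [set: R] &
          forall t x, t \in `]t0, t1[ -> x \in `]x0, x1[ -> u t x = 0]) :
  forall t x, lifetime T t -> u t x = 0.
Proof.
have [t0 [t1 [a [b [t01 ab rect u_eq0]]]]] := u_rect.
have [_ cu u0E _] := u_sol.
have u3 t : lifetime T t -> sobolev 3 (u t) by case: u_sol => -[+ _] _ _ _; exact.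
have l0 : lifetime T 0 by [].
pose tau := (t0 + t1) / 2.
have tau01 : tau \in `]t0, t1[ by rewrite in_itv/= /tau; apply/andP; split; lra.
have ltau : lifetime T tau.
  have /rect[] : (`]t0, t1[ `*` `]a, b[) (tau, (a + b) / 2); last by [].
  by split => //=; rewrite in_itv/=; apply/andP; split; lra.
have mE0 : momentum (u 0) = momentum u0 by congr momentum; apply: funext.
have cm t : lifetime T t -> continuous (momentum (u t)).
  move=> lt; have [p1 p2 p3 _ _] := sobolev3_regular (u3 t lt) (cu t lt).
  exact: primitive_continuous (primitiveB p1 p3).
have [p1 p2 p3 _ _] := sobolev3_regular (u3 _ ltau) (cu _ ltau).
have c1 := primitive_continuous p2; have c2 := primitive_continuous p3.
have [L0 _] := L2_derive1n (u3 _ ltau) (cu _ ltau) (isT : (0 <= 2)%N).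
have [L1 _] := L2_derive1n (u3 _ ltau) (cu _ ltau) (isT : (1 <= 2)%N).
have [L2' _] := L2_derive1n (u3 _ ltau) (cu _ ltau) (isT : (2 <= 2)%N).
rewrite derive1n0 in L0; rewrite derive1n1 in L1.
have b0 := primitive_bounded p1 L0 L1; have b1 := primitive_bounded p2 L1 L2'.
move: (Num.sqrt _) b0 => K0 b0; move: (Num.sqrt _) b1 => K1 b1.
have d1 := primitive_is_derive p1 c1; have d2 := primitive_is_derive p2 c2.
have posphi (x : R) : 0 <= Num.max x 0 ^+ 2 by exact: sqr_ge0.
have pos0 : Num.max (0 : R) 0 ^+ 2 = 0 by rewrite maxxx expr0n.
have dpos0 : 2 * Num.max (0 : R) 0 = 0 by rewrite maxxx mulr0.
have bK0 x : `|u tau x| <= Num.max K0 K1 by rewrite le_max b0.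
have bK1 x : `|derive1 (u tau) x| <= Num.max K0 K1 by rewrite le_max b1 orbT.
have helm x : derive1n 2 (u tau) x = u tau x.
  case: m0_sign => m0.
  (* The energy of the negative part vanishes at time 0, hence at [tau]. So m >= 0 there, which
     reads u_xx <= u, as [helmholtz_zero] requires. *)
  - have C := C11_comp_opp (@C11_pos_part R).
    have z0 : (fun x : R => Num.max (- x) 0 ^+ 2) 0 = 0 by rewrite /= oppr0.
    have dz0 : (fun x : R => - (2 * Num.max (- x) 0)) 0 = 0 by rewrite /= oppr0 dpos0 oppr0.
    have E0 : energy (fun x : R => Num.max (- x) 0 ^+ 2) (momentum (u 0)) = 0.
      apply: energy0 => y; rewrite mE0.
      have /max_idPr -> : - momentum u0 y <= 0 by rewrite oppr_le0; exact: m0.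
      by rewrite expr0n.
    have E := energy_momentum_eq0 u_sol C z0 dz0 (fun x => posphi (- x)) l0 ltau E0.
    have S := energy_eq0 C z0 dz0 (fun x => posphi (- x)) (cm _ ltau) (L2_momentum u_sol ltau) E.
    apply: (helmholtz_zero ab d1 d2 bK0 bK1) => [y|y yab]; last exact: u_eq0.
    have /eqP := S y; rewrite sqrf_eq0 => /eqP/max_idPr.
    by rewrite oppr_le0 /momentum subr_ge0.
  (* The mirror case: the energy of the positive part vanishes, u_xx >= u at [tau], and
     [helmholtz_zero] is applied to -u. *)
  - have C := @C11_pos_part R.
    have E0 : energy (fun x : R => Num.max x 0 ^+ 2) (momentum (u 0)) = 0.
      apply: energy0 => y; rewrite mE0.
      have /max_idPr -> := m0 y.
      by rewrite expr0n.
    have E := energy_momentum_eq0 u_sol C pos0 dpos0 posphi l0 ltau E0.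
    have S := energy_eq0 C pos0 dpos0 posphi (cm _ ltau) (L2_momentum u_sol ltau) E.
    apply: oppr_inj.
    apply: (@helmholtz_zero R (fun x => - u tau x) (fun x => - derive1 (u tau) x)
      (fun x => - derive1n 2 (u tau) x) a b (Num.max K0 K1) ab).
    + by move=> y; rewrite normrN.
    + by move=> y; rewrite normrN.
    + move=> y; have /eqP := S y; rewrite sqrf_eq0 => /eqP/max_idPr.
      by rewrite /momentum subr_le0 lerN2.
    + by move=> y yab; rewrite (u_eq0 _ _ tau01 yab) oppr0.
(* The square detects m = 0 itself and not just its sign, so its energy carries m = 0 from [tau] to
   every other time. *)
have sq0 : (fun x : R => x ^+ 2) 0 = 0 by rewrite /= expr0n.
have dsq0 : (fun x : R => 2 * x) 0 = 0 by rewrite /= mulr0.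
have Etau : energy (fun x : R => x ^+ 2) (momentum (u tau)) = 0.
  by apply: energy0 => y; rewrite /momentum helm subrr expr0n.
move=> t x lt.
have Et := energy_momentum_eq0 u_sol (@C11_sqr R) sq0 dsq0 (@sqr_ge0 R) ltau lt Etau.
have mt0 := energy_eq0 (@C11_sqr R) sq0 dsq0 (@sqr_ge0 R) (cm _ lt) (L2_momentum u_sol lt) Et.
have [q1 q2 _ _ _] := sobolev3_regular (u3 _ lt) (cu _ lt).
have [Lt0 _] := L2_derive1n (u3 _ lt) (cu _ lt) (isT : (0 <= 2)%N).
have [Lt1 _] := L2_derive1n (u3 _ lt) (cu _ lt) (isT : (1 <= 2)%N).
rewrite derive1n0 in Lt0; rewrite derive1n1 in Lt1.
apply: (primitive_helmholtz_zero q1 q2 Lt0 Lt1) => y.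
by have /eqP := mt0 y; rewrite sqrf_eq0 /momentum subr_eq0 => /eqP.
Qed.
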